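(* Let $w$ be a function on $[-1,1]$ for which there are constants $m,R>0$ with $w(x)\ge m$ for every $-1\le x\le 1$ and $|w(x)-w(y)|\le R\,(y-x)$ for every $-1\le x<y\le 1$. Then there exists a constant $C(w)>0$ depending only on $w$ (in particular independent of $n$ and $x$) such that for every integer $n\ge 1$ and every point $x\in(-1,1)$ at which $\pi$ is differentiable, $$-C(w)\frac{\lambda(x)}{1-x}\le \pi'(x)-w(x)\le C(w)\,\lambda(x)\min\left\{\frac{1}{1+x},\,n^2\right\}.$$
   Context: Fix an integer $n\ge1$. Let $\mathcal{M}_n$ be the set of positive Borel measures $\mu$ on $[-1,1]$ such that $\int_{-1}^1 p(t)w(t)\,dt=\int p\,d\mu$ for every polynomial $p$ of degree at most $2n-1$. For $-1\le x\le 1$ define $\pi(x):=\sup_{\mu\in\mathcal{M}_n}\mu([-1,x])$ and $\lambda(x):=\sup_{\mu\in\mathcal{M}_n}\mu(\{x\})$. (Both depend on $n$ and $w$.) *)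

(* Defs.v *)
From HB Require Import structures.
From mathcomp Require Import all_boot all_order all_algebra.
From mathcomp Require Import all_classical all_reals all_analysis.
Set Implicit Arguments. Unset Strict Implicit. Unset Printing Implicit Defensive.
Import Order.TTheory GRing.Theory Num.Theory.
Local Open Scope classical_set_scope.
Local Open Scope ring_scope.

(* Positive Borel measures on [-1,1], represented as measures on the Borel
   sigma-algebra of R that vanish outside [-1,1], whose moments of order
   <= 2n-1 coincide with those of w(t) dt on [-1,1]. *)
Definition quad_measures (R : realType) (n : nat) (w : R -> R)
  : set {measure set R -> \bar R} :=
  [set mu : {measure set R -> \bar R} | mu (~` `[-1, 1]) = 0%E /\
     forall p : {poly R}, (size p <= (2 * n)%N)%N ->
       (\int[mu]_(t in `[(-1)%R, 1%R]) (p.[t])%:E =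
        \int[lebesgue_measure]_(t in `[(-1)%R, 1%R]) (p.[t] * w t)%:E)%E].

(* pi(x) = sup_{mu in M_n} mu([-1,x]) (a finite value: bounded by \int w) *)
Definition pi_fun (R : realType) (n : nat) (w : R -> R) (x : R) : R :=
  fine (ereal_sup [set mu `[-1, x]%classic | mu in quad_measures n w]).

Definition lambda_fun (R : realType) (n : nat) (w : R -> R) (x : R) : R :=
  fine (ereal_sup [set mu [set x] | mu in quad_measures n w]).

(* Main.v *)
(* Write [L p] for the integral of [p w] over [-1, 1].  Minimising [L] over the
   nonnegative polynomials [p] of degree at most [2n-1] with [p(x) = 1] gives a
   polynomial whose zeros, together with [x], are the nodes of a quadrature formula
   exact for [L].  Hermite interpolation at these nodes yields polynomials
   [Pp >= 1_[-1,x]] and [Pm <= 1_[-1,x)], sharp on the nodes, so that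
   [pi(x) = L Pp] and [lambda(x) >= L (Pp - Pm)]; as [L Pm] is at most the
   integral [W(x)] of [w] over [-1, x], this gives [0 <= pi - W <= lambda].
   Precomposing [Pp] with an affine contraction of [-1, 1] fixing [1] (or [-1])
   bounds the decrease (or increase) of [pi - W] near [x], hence the bounds with
   [1 - x] and [1 + x].  When [1 + x < 1/(8n^2)], a Fejer-type polynomial gives
   [pi(x) = O(1/n^2)], so [Pp] is bounded on [-1, 1] and [Pp' = O(n^2)] by Markov's
   inequality; thus [pi(x+h) <= (1 + O(n^2 h)) pi(x)], with [pi(x) = O(lambda(x))]. *)
Require Import Defs.
From HB Require Import structures.
From mathcomp Require Import all_boot all_order all_algebra.
From mathcomp Require Import all_classical all_reals all_analysis.
From mathcomp Require Import measurable_realfun.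
From mathcomp Require Import ring lra zify.
Set Implicit Arguments.
Unset Strict Implicit.
Unset Printing Implicit Defensive.
Import Order.TTheory GRing.Theory Num.Theory.
Import numFieldNormedType.Exports.
Local Open Scope classical_set_scope.
Local Open Scope ring_scope.

(** * Bezout pairs and zeros of nonnegative polynomials *)

(** No formula for the derivative of pi is available, so each estimate compares pi at two nearby
    points by carrying an optimal majorant from one point to the other. Such a comparison goes in
    one direction only; this suffices, since differentiability lets the derivative be read off from
    right or left difference quotients at will. The quantity carried by the contractions is the gap
    [pi - W] and not pi: the gap is at most lambda, and it is an integral of nonnegative functions
    against [w], so that a relative change 1 + O(1 - s) of the weight costs only a multiple (1 - s)
    of the gap itself. The Lipschitz bound and the lower bound [m] on [w] together make the change
    of weight relative. The contraction towards -1 loses a factor 1/(1 + x), too much once 1 + x is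
    well below 1/n^2. Near -1, however, pi itself is O(lambda), so a relative bound on the
    increments of pi is enough there. *)

Definition prodL (R : realType) (a : seq R) : {poly R} := \prod_(z <- a) ('X - z%:P).
(** The factors are [z - X], so that both products are positive between the nodes of [a] and those
    of [b] and no powers of -1 have to be tracked. *)
Definition prodR (R : realType) (b : seq R) : {poly R} := \prod_(z <- b) (z%:P - 'X).

Lemma prodLE (R : realType) (a : seq R) t : (prodL a).[t] = \prod_(z <- a) (t - z).
Proof. by rewrite horner_prod; apply: eq_bigr => z _; rewrite !hornerE. Qed.

Lemma prodRE (R : realType) (b : seq R) t : (prodR b).[t] = \prod_(z <- b) (z - t).
Proof. by rewrite horner_prod; apply: eq_bigr => z _; rewrite !hornerE. Qed.

Lemma size_prodL (R : realType) (a : seq R) : size (prodL a) = (size a).+1.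
Proof. exact: size_prod_XsubC. Qed.

Lemma size_CsubX (R : realType) (z : R) : size (z%:P - 'X : {poly R}) = 2%N.
Proof. by rewrite -opprB size_polyN size_XsubC. Qed.

Lemma size_prodR (R : realType) (b : seq R) : size (prodR b) = (size b).+1.
Proof.
rewrite /prodR; elim: b => [|z b IH]; first by rewrite big_nil size_poly1.
have nz : (z%:P - 'X : {poly R}) != 0 by rewrite -size_poly_eq0 size_CsubX.
rewrite big_cons size_mul // ?size_CsubX ?IH //.
by rewrite -size_poly_eq0 IH.
Qed.

Lemma prodL_gt0 (R : realType) (a : seq R) t :
  {in a, forall z : R, z < t} -> 0 < (prodL a).[t].
Proof.
by rewrite prodLE big_seq => h; apply: prodr_gt0 => z /h; rewrite subr_gt0.
Qed.

Lemma prodL_ge0 (R : realType) (a : seq R) t :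
  {in a, forall z : R, z <= t} -> 0 <= (prodL a).[t].
Proof.
by rewrite prodLE big_seq => h; apply: prodr_ge0 => z /h; rewrite subr_ge0.
Qed.

Lemma prodR_gt0 (R : realType) (b : seq R) t :
  {in b, forall z : R, t < z} -> 0 < (prodR b).[t].
Proof.
by rewrite prodRE big_seq => h; apply: prodr_gt0 => z /h; rewrite subr_gt0.
Qed.

Lemma prodR_ge0 (R : realType) (b : seq R) t :
  {in b, forall z : R, t <= z} -> 0 <= (prodR b).[t].
Proof.
by rewrite prodRE big_seq => h; apply: prodr_ge0 => z /h; rewrite subr_ge0.
Qed.

Lemma coprimep_prodLR (R : realType) (a b : seq R) :
  {in a & b, forall y z : R, y < z} -> coprimep (prodL a) (prodR b).
Proof.
elim: a => [|y a IH] ab; first by rewrite /prodL big_nil coprime1p.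
rewrite /prodL big_cons coprimepMl IH ?andbT; last first.
  by move=> u v ua vb; apply: ab; rewrite // inE ua orbT.
rewrite coprimep_sym coprimep_XsubC /root gt_eqF// prodR_gt0// => z zb.
by apply: ab => //; exact: mem_head.
Qed.

Lemma bezout_unique (R : realType) (A B U U' V V' : {poly R}) :
  coprimep A B -> (size U < size A)%N -> (size U' < size A)%N ->
  B * U + A * V = B * U' + A * V' -> V = V'.
Proof.
move=> AB sU sU' e.
have A0 : A != 0 by rewrite -size_poly_gt0; exact: leq_ltn_trans sU.
have e1 : B * (U - U') = A * (V' - V).
  by apply/eqP; rewrite -subr_eq0; apply/eqP; move: e => /eqP; rewrite -subr_eq0 => /eqP <-; ring.
have : A %| U - U' by rewrite -(Gauss_dvdpr _ AB) e1 dvdp_mulr.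
move/(dvdp_leq _) => h.
have UU : U - U' = 0.
  apply/eqP; apply: contraT => /h; rewrite leqNgt => /negP; case.
  by rewrite (leq_ltn_trans (size_polyD _ _))// size_polyN gtn_max sU.
move: e1; rewrite UU mulr0 => /esym/eqP; rewrite mulf_eq0 (negbTE A0)/= subr_eq0.
by move/eqP.
Qed.

(* The terms [prodR b * U] and [prodL a * V] are the Hermite interpolants of the
   indicators of the two halves of a node set.  The sign of [U] is clear when the
   nodes of [a] are added last, that of [V] when those of [b] are; uniqueness of
   the Bezout pair reconciles the two orders. *)
Lemma bezout_nodes (R : realType) (a b : seq R) :
  {in a & b, forall y z : R, y < z} -> (0 < size a + size b)%N ->
  exists U V : {poly R},
    [/\ prodR b * U + prodL a * V = 1, (size U <= size a)%N, (size V <= size b)%N,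
      forall t : R, {in a, forall y : R, y <= t} -> 0 <= U.[t] &
      forall t : R, {in b, forall z : R, t <= z} -> 0 <= V.[t]].
Proof.
have [n] := ubnP (size a + size b)%N.
elim: n a b => // n IH [|a0 a] [|b0 b] // sn ab _.
- exists 0, 1; rewrite mulr0 add0r /prodL big_nil mulr1 size_poly0 size_poly1.
  by split=> // t _; rewrite hornerE.
- exists 1, 0; rewrite mulr0 addr0 /prodR big_nil mulr1 size_poly0 size_poly1.
  by split=> // t _; rewrite hornerE.
have [|||U1 [V1 [e1 sU1 sV1 U1p V1p]]] := IH a (b0 :: b).
- by rewrite /= in sn *; lia.
- by move=> u v ua vb; apply: ab; rewrite // inE ua orbT.
- by rewrite /= addnS.
have [|||U2 [V2 [e2 sU2 sV2 U2p V2p]]] := IH (a0 :: a) b.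
- by rewrite /= in sn *; lia.
- by move=> u v ua vb; apply: ab; rewrite // inE vb orbT.
- by [].
have Ba0 : 0 < (prodR (b0 :: b)).[a0].
  by apply: prodR_gt0 => z zb; apply: ab => //; exact: mem_head.
have Ab0 : 0 < (prodL (a0 :: a)).[b0].
  by apply: prodL_gt0 => z zb; apply: ab => //; exact: mem_head.
(* Adding [c1 *: prodL a] to [U1] and subtracting [c1 *: prodR (b0 :: b)] from [V1] preserves the
   Bezout identity. This [c1] makes the new second term vanish at [a0], so that [X - a0] splits off
   and completes [prodL (a0 :: a)]. The constant [c2] does the same at [b0]. *)
set c1 := V1.[a0] / (prodR (b0 :: b)).[a0].
set c2 := U2.[b0] / (prodL (a0 :: a)).[b0].
have c1p : 0 <= c1.
  apply: divr_ge0; last exact: ltW.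
  by apply: V1p => z zb; apply/ltW/ab => //; exact: mem_head.
have c2p : 0 <= c2.
  apply: divr_ge0; last exact: ltW.
  by apply: U2p => z zb; apply/ltW/ab => //; exact: mem_head.
have /factor_theorem[V eV] : root (V1 - c1 *: prodR (b0 :: b)) a0.
  by rewrite /root !hornerE /c1 divfK ?subrr// gt_eqF.
have /factor_theorem[U eU] : root (U2 - c2 *: prodL (a0 :: a)) b0.
  by rewrite /root !hornerE /c2 divfK ?subrr// gt_eqF.
have AE : prodL (a0 :: a) = ('X - a0%:P) * prodL a by rewrite /prodL big_cons.
have BE : prodR (b0 :: b) = (b0%:P - 'X) * prodR b by rewrite /prodR big_cons.
have sV : (size V <= size (b0 :: b))%N.
  have [->|V0] := eqVneq V 0; first by rewrite size_poly0.
  rewrite -ltnS -(size_prodR (b0 :: b)).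
  have -> : (size V).+1 = size (V1 - c1 *: prodR (b0 :: b)).
    by rewrite eV size_Mmonic ?monicXsubC// size_XsubC addn2.
  rewrite (leq_trans (size_polyD _ _))// geq_max size_polyN.
  by rewrite size_scale_leq andbT size_prodR leqW.
have sU : (size U <= size (a0 :: a))%N.
  have [->|U0] := eqVneq U 0; first by rewrite size_poly0.
  rewrite -ltnS -(size_prodL (a0 :: a)).
  have -> : (size U).+1 = size (U2 - c2 *: prodL (a0 :: a)).
    by rewrite eU size_Mmonic ?monicXsubC// size_XsubC addn2.
  rewrite (leq_trans (size_polyD _ _))// geq_max size_polyN.
  by rewrite size_scale_leq andbT size_prodL leqW.
pose U' := U1 + c1 *: prodL a; pose V' := V2 + c2 *: prodR b.
have sU' : (size U' <= size (a0 :: a))%N.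
  rewrite (leq_trans (size_polyD _ _))// geq_max leqW//=.
  by rewrite (leq_trans (size_scale_leq _ _))// size_prodL.
have e1' : prodR (b0 :: b) * U' + prodL (a0 :: a) * V = 1.
  rewrite -e1 AE /U' -[in RHS](subrK (c1 *: prodR (b0 :: b)) V1) eV -!mul_polyC.
  by ring.
(* The minus sign arises because the factor split off is [X - b0], while [prodR] contains
   [b0 - X]. *)
have e2' : prodR (b0 :: b) * - U + prodL (a0 :: a) * V' = 1.
  rewrite -e2 BE /V' -[in RHS](subrK (c2 *: prodL (a0 :: a)) U2) eU -!mul_polyC.
  by ring.
have VV' : V = V'.
  apply: (@bezout_unique _ (prodL (a0 :: a)) (prodR (b0 :: b)) U' (- U)).
  - exact: coprimep_prodLR.
  - by rewrite size_prodL ltnS.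
  - by rewrite size_prodL size_polyN ltnS.
  - by rewrite e1' e2'.
exists U', V; split=> // t h.
- rewrite !hornerE addr_ge0//.
    by apply: U1p => y ya; apply: h; rewrite inE ya orbT.
  by rewrite mulr_ge0// prodL_ge0// => y ya; apply: h; rewrite inE ya orbT.
- rewrite VV' !hornerE addr_ge0//.
    by apply: V2p => y ya; apply: h; rewrite inE ya orbT.
  by rewrite mulr_ge0// prodR_ge0// => y ya; apply: h; rewrite inE ya orbT.
Qed.

(** Continuity made explicit: p(t) = p(z) + g(t)(t - z) with [g] bounded by [ub], so if p(z) were
    negative, p would still be negative at distance [e] from z. The bound [(v - u) / 2] on [e]
    leaves room for such a point on at least one side of z. *)
Lemma poly_ge0_punctured (R : realType) (p : {poly R}) (u v z : R) :
  u < v -> u <= z <= v ->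
  (forall t : R, u <= t <= v -> t != z -> 0 <= p.[t]) -> 0 <= p.[z].
Proof.
move=> uv zuv h; rewrite leNgt; apply/negP => pz.
have /factor_theorem[g eg] : root (p - p.[z]%:P) z by rewrite /root !hornerE subrr.
have pE t : p.[t] = p.[z] + g.[t] * (t - z).
  have : (p - p.[z]%:P).[t] = (g * ('X - z%:P)).[t] by rewrite eg.
  by rewrite !hornerE => /eqP; rewrite subr_eq => /eqP ->; rewrite addrC.
have [ub hub] := poly_itv_bound g u v.
have ub0 : 0 <= ub by apply: le_trans (hub z zuv).
pose e := Num.min ((v - u) / 2) (- p.[z] / (2 * (ub + 1))).
have e0 : 0 < e.
  rewrite lt_min !divr_gt0 ?mulr_gt0 ?subr_gt0 ?oppr_gt0//.
  by rewrite ltr_wpDl.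
have e1 : e <= (v - u) / 2 by rewrite ge_min lexx.
have e2 : e * (2 * (ub + 1)) <= - p.[z].
  by rewrite -ler_pdivlMr ?ge_min ?lexx ?orbT// mulr_gt0// ltr_wpDl.
have [t [t1 t2 t3]] : exists t, [/\ u <= t <= v, t != z & `|t - z| = e].
  have [zm|zm] := leP z ((u + v) / 2).
  - exists (z + e); rewrite addrAC subrr add0r gtr0_norm//; split=> //; first lra.
    by rewrite gt_eqF// ltrDl.
  - exists (z - e); rewrite addrAC subrr add0r normrN gtr0_norm//; split=> //; first lra.
    by rewrite lt_eqF// gtrBl.
have := h t t1 t2; rewrite pE => h1.
have h2 : g.[t] * (t - z) <= ub * e.
  by rewrite -t3 (le_trans (ler_norm _))// normrM ler_wpM2r// hub.
nra.
Qed.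

Lemma poly_ge0_factor (R : realType) (p f : {poly R}) (z : R) :
  -1 <= z <= 1 -> (forall t : R, -1 <= t <= 1 -> 0 <= (p * f).[t]) ->
  (forall t : R, -1 <= t <= 1 -> t != z -> 0 < f.[t]) ->
  forall t : R, -1 <= t <= 1 -> 0 <= p.[t].
Proof.
move=> z1 pf f0.
have h t : -1 <= t <= 1 -> t != z -> 0 <= p.[t].
  by move=> t1 tz; have := pf t t1; rewrite hornerM pmulr_lge0// f0.
move=> t t1; have [->|] := eqVneq t z; last exact: h.
by apply: (@poly_ge0_punctured _ _ (-1) 1) => //; lra.
Qed.

(** The quotient p / (X - z) is nonnegative to the right of z and nonpositive to its left, hence it
    vanishes at z as well. *)
Lemma nonneg_poly_root (R : realType) (p : {poly R}) (z : R) :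
  -1 < z < 1 -> root p z -> (forall t : R, -1 <= t <= 1 -> 0 <= p.[t]) ->
  exists q : {poly R}, p = q * ('X - z%:P) ^+ 2.
Proof.
move=> z1 /factor_theorem[r ->] rp.
have rpE t : (r * ('X - z%:P)).[t] = r.[t] * (t - z) by rewrite !hornerE.
have rz1 : 0 <= r.[z].
  apply: (@poly_ge0_punctured _ _ z 1); [lra|lra|move=> t t1 tz].
  have : 0 <= r.[t] * (t - z) by rewrite -rpE rp//; lra.
  by rewrite pmulr_lge0// subr_gt0 lt_neqAle eq_sym tz; case/andP: t1.
have rz2 : 0 <= (- r).[z].
  apply: (@poly_ge0_punctured _ _ (-1) z); [lra|lra|move=> t t1 tz].
  have : 0 <= r.[t] * (t - z) by rewrite -rpE rp//; lra.
  by rewrite -mulrNN -hornerN pmulr_lge0// oppr_gt0 subr_lt0 lt_neqAle tz; case/andP: t1.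
have /factor_theorem[q ->] : root r z.
  by rewrite /root eq_le rz1 andbT -oppr_ge0 -hornerN.
by exists q; rewrite expr2 mulrA.
Qed.

(** Zeros are divided out one at a time, an interior one with a double factor and an endpoint with a
    simple one. Each factor thus has constant sign on [-1, 1], the quotient stays nonnegative there,
    and the total number of entries stays below [size p]. Repeated entries encode the Hermite
    conditions on derivatives. *)
Lemma nonneg_poly_nodes (R : realType) (x : R) (p : {poly R}) :
  -1 < x < 1 -> p.[x] != 0 -> (forall t : R, -1 <= t <= 1 -> 0 <= p.[t]) ->
  exists a b : seq R,
    [/\ {in a, forall y : R, -1 <= y < x}, {in b, forall y : R, x < y <= 1},
      (size a + size b < size p)%N,
      forall t : R, -1 <= t <= 1 -> 0 <= (prodL a).[t] /\ 0 <= (prodR b).[t] &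
      forall z : R, -1 <= z <= 1 -> root p z -> z \in a ++ b].
Proof.
move=> x1; have [n] := ubnP (size p).
elim: n p => // n IH p sp px pp.
have p0 : p != 0 by apply: contraNneq px => ->; rewrite horner0.
have [[z [z1 pz]]|noroot] := pselect (exists z, -1 <= z <= 1 /\ root p z); last first.
  exists [::], [::]; split=> //.
  - by rewrite lt0n size_poly_eq0.
  - by move=> t _; rewrite /prodL /prodR !big_nil !hornerE.
  - by move=> z z1 pz; case: noroot; exists z.
have zx : z != x by apply: contraNneq px => <-; exact: pz.
have [k [q [k0 eL eR]]] : exists k (q : {poly R}), [/\ (0 < k)%N,
    z < x -> p = q * prodL (nseq k z) /\
      (forall t : R, -1 <= t <= 1 -> t != z -> 0 < (prodL (nseq k z)).[t]) &
    x < z -> p = q * prodR (nseq k z) /\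
      (forall t : R, -1 <= t <= 1 -> t != z -> 0 < (prodR (nseq k z)).[t])].
  have [z1'|] := boolP (-1 < z < 1).
    have [q ->] := nonneg_poly_root z1' pz pp.
    exists 2%N, q; split=> // _; rewrite /prodL /prodR /= !big_cons big_nil mulr1.
    - split; first by rewrite expr2.
      by move=> t _ tz; rewrite !hornerE -expr2 exprn_even_gt0//= subr_eq0.
    - split; first by rewrite expr2 -[in LHS](mulrNN ('X - _)) opprB.
      by move=> t _ tz; rewrite !hornerE -expr2 exprn_even_gt0//= subr_eq0 eq_sym.
  rewrite negb_and -!leNgt => /orP[] zb.
  - have /factor_theorem[q ->] := pz.
    exists 1%N, q; split=> // [_|xz]; last by exfalso; lra.
    rewrite /prodL big_cons big_nil mulr1; split=> // t t1 tz.
    rewrite !hornerE subr_gt0 lt_neqAle eq_sym tz; lra.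
  - have /factor_theorem[q ->] := pz.
    exists 1%N, (- q); split=> // [zx'|_]; first by exfalso; lra.
    rewrite /prodR big_cons big_nil mulr1; split=> [|t t1 tz]; first by rewrite mulNr -mulrN opprB.
    rewrite !hornerE subr_gt0 lt_neqAle tz; lra.
(* The part common to zeros on either side of [x]: [f] is the factor divided out, positive away from
   [z], and the induction hypothesis is applied to the quotient [q]. *)
have step (f : {poly R}) : p = q * f -> size f = k.+1 ->
    (forall t : R, -1 <= t <= 1 -> t != z -> 0 < f.[t]) ->
    (forall t : R, -1 <= t <= 1 -> 0 <= f.[t]) /\
    exists a b : seq R,
    [/\ {in a, forall y : R, -1 <= y < x}, {in b, forall y : R, x < y <= 1},
      (k + (size a + size b) < size p)%N,
      forall t : R, -1 <= t <= 1 -> 0 <= (prodL a).[t] /\ 0 <= (prodR b).[t] &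
      forall y : R, -1 <= y <= 1 -> root p y -> (y == z) || (y \in a ++ b)].
  move=> e sf f0.
  have ff t : -1 <= t <= 1 -> 0 <= f.[t].
    move=> t1; have [->|tz] := eqVneq t z; last by rewrite ltW// f0.
    by apply: (@poly_ge0_punctured _ f (-1) 1) => // u u1 uz; rewrite ltW// f0.
  split=> //.
  have q0 : q != 0 by apply: contraNneq p0; rewrite e => ->; rewrite mul0r.
  have f00 : f != 0 by rewrite -size_poly_eq0 sf.
  have sq : (size p = size q + k)%N by rewrite e size_mul// sf addnS.
  have [||t t1|a [b [ha hb sab hab hr]]] := IH q.
  - by move: k0 sp; rewrite sq; clear; lia.
  - by apply: contraNneq px; rewrite e hornerM => ->; rewrite mul0r.
  - by apply: (@poly_ge0_factor _ q f z) => // u u1; rewrite -e pp.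
  exists a, b; split=> //; first by move: sab; rewrite sq; clear; lia.
  move=> y y1; rewrite e rootM => /orP[/(hr _ y1)->|]; first by rewrite orbT.
  by apply: contraTT; rewrite negb_or => /andP[yz _]; rewrite /root gt_eqF// f0.
have [zlt|zgt] : z < x \/ x < z by move: zx; rewrite neq_lt => /orP.
- have [e f0] := eL zlt.
  have [ff [a [b [ha hb sab hab hr]]]] :=
    step _ e (etrans (size_prodL _) (congr1 S (size_nseq _ _))) f0.
  exists (nseq k z ++ a), b; split=> //.
  + move=> y; rewrite mem_cat mem_nseq k0 => /orP[/eqP ->|/ha//]; lra.
  + by rewrite size_cat size_nseq -addnA.
  + move=> t t1; have [A B] := hab t t1; split=> //.
    by rewrite /prodL big_cat hornerM mulr_ge0// ff.
  + move=> y y1 /(hr _ y1) /orP[/eqP->|]; first by rewrite !mem_cat mem_nseq k0 eqxx.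
    by rewrite !mem_cat => /orP[] ->; rewrite ?orbT.
- have [e f0] := eR zgt.
  have [ff [a [b [ha hb sab hab hr]]]] :=
    step _ e (etrans (size_prodR _) (congr1 S (size_nseq _ _))) f0.
  exists a, (nseq k z ++ b); split=> //.
  + move=> y; rewrite mem_cat mem_nseq k0 => /orP[/eqP ->|/hb//]; lra.
  + by rewrite size_cat size_nseq addnCA.
  + move=> t t1; have [A B] := hab t t1; split=> //.
    by rewrite /prodR big_cat hornerM mulr_ge0// ff.
  + move=> y y1 /(hr _ y1) /orP[/eqP->|]; first by rewrite !mem_cat mem_nseq k0 eqxx !orbT.
    by rewrite !mem_cat => /orP[] ->; rewrite ?orbT.
Qed.

(** * Markov's inequality *)

Lemma horner_deriv_prodL (R : realType) (a : seq R) (t : R) :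
  {in a, forall z, z <= t} -> 0 <= (prodL a)^`().[t].
Proof.
elim: a => [|z a IH] h; first by rewrite /prodL big_nil derivC horner0.
have ha : {in a, forall z, z <= t} by move=> y ya; apply: h; rewrite inE ya orbT.
rewrite /prodL big_cons derivM derivXsubC mul1r !hornerE.
rewrite addr_ge0 ?prodL_ge0// mulr_ge0 ?IH// subr_ge0 h//; exact: mem_head.
Qed.

(** Chebyshev polynomials of the first kind, by their three-term recurrence. *)
Fixpoint cheb (R : realType) (n : nat) : {poly R} :=
  if n is n1.+1 then
    if n1 is n2.+1 then 'X *+ 2 * cheb R n1 - cheb R n2 else 'X
  else 1.

Lemma chebSS (R : realType) n : cheb R n.+2 = 'X *+ 2 * cheb R n.+1 - cheb R n.
Proof. by []. Qed.

Lemma nat_ind2 (P : nat -> Prop) :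
  P 0%N -> P 1%N -> (forall n, P n -> P n.+1 -> P n.+2) -> forall n, P n.
Proof.
move=> P0 P1 PS n; suff : P n /\ P n.+1 by case.
by elim: n => // n [Pn Pn1]; split=> //; exact: PS.
Qed.

Lemma size_cheb (R : realType) n : (size (cheb R n) <= n.+1)%N.
Proof.
elim/nat_ind2: n => [||n IH0 IH1]; rewrite ?size_poly1 ?size_polyX// chebSS.
have h : (size ('X *+ 2 * cheb R n.+1)%R <= n.+3)%N.
  rewrite mulrnAl -scaler_nat (leq_trans (size_scale_leq _ _))//.
  by rewrite mulrC (leq_trans (size_polyMleq _ _))// size_polyX addn2.
rewrite (leq_trans (size_polyD _ _))// geq_max h size_polyN.
exact: leq_trans IH0 (leqW (leqnSn _)).
Qed.

Lemma cheb_cos (R : realType) n (u : R) : (cheb R n).[cos u] = cos (n%:R * u).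
Proof.
elim/nat_ind2: n => [||n IH0 IH1]; first by rewrite hornerE mul0r cos0.
  by rewrite hornerE mul1r.
rewrite chebSS !hornerE IH0 IH1.
have -> : n.+2%:R * u = n.+1%:R * u + u by rewrite -!natr1; ring.
have -> : n%:R * u = n.+1%:R * u - u by rewrite -!natr1; ring.
by rewrite cosB cosD; ring.
Qed.

Lemma cheb1 (R : realType) n : (cheb R n).[1] = 1.
Proof. by rewrite -cos0 cheb_cos mulr0. Qed.

Lemma deriv_cheb1 (R : realType) n : (cheb R n)^`().[1] = n%:R ^+ 2.
Proof.
elim/nat_ind2: n => [||n IH0 IH1].
- by rewrite derivC horner0 expr0n.
- by rewrite derivX hornerE expr1n.
rewrite chebSS derivB derivM derivMn derivX !hornerE IH0 IH1 cheb1 -!natr1; ring.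
Qed.

Lemma cheb_le1 (R : realType) n (t : R) : -1 <= t <= 1 -> `|(cheb R n).[t]| <= 1.
Proof.
move=> t1; rewrite -[t]acosK ?in_itv//= cheb_cos ler_norml cos_geN1 cos_le1//.
Qed.

(* Classical alternation argument: [cheb d - p] has a root between any two
   consecutive extremal points of [cheb d], so all its roots lie to the left of
   [1], and its leading coefficient is positive. *)
Lemma endpoint_markov_lt1 (R : realType) (d : nat) (p : {poly R}) :
  (size p <= d.+1)%N -> (forall t : R, -1 <= t <= 1 -> `|p.[t]| < 1) ->
  p^`().[1] <= d%:R ^+ 2.
Proof.
case: d => [|d] sp p1.
  by rewrite (size1_polyC sp) derivC horner0 expr0n.
pose q := cheb R d.+1 - p.
pose eta (j : nat) : R := cos (j%:R * (pi / d.+1%:R)).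
have d0 : 0 < d.+1%:R :> R by rewrite ltr0n.
have eta_in j : -1 <= eta j <= 1 by rewrite cos_geN1 cos_le1.
have chebE j : (cheb R d.+1).[eta j] = (-1) ^+ j.
  rewrite cheb_cos (_ : _ * _ = pi *+ j); last first.
    by rewrite mulrCA [_ * (_ / _)]mulrC divfK ?gt_eqF// mulr_natl.
  elim: j => [|j IH]; first by rewrite cos0.
  by rewrite mulrS addrC cosDpi IH exprS mulN1r.
have eta_lt i j : (i < j)%N -> (j <= d.+1)%N -> eta j < eta i.
  move=> ij jd.
  have pid : 0 < (pi : R) / d.+1%:R by rewrite divr_gt0 ?pi_gt0.
  have inI k : (k <= d.+1)%N -> k%:R * (pi / d.+1%:R) \in `[0, (pi : R)].
    move=> kd; rewrite in_itv/= mulr_ge0 ?ler0n ?(ltW pid)//=.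
    by rewrite mulrA ler_pdivrMr// mulrC ler_pM2l ?pi_gt0// ler_nat.
  rewrite /eta ltr_cos ?inI ?(leq_trans (ltnW ij))//.
  by rewrite ltr_pM2r// ltr_nat.
(* The strict bound on [p] gives strict signs at the extremal points, so the roots found between
   them avoid these points and are pairwise distinct. *)
have qsgn j : 0 < (-1) ^+ j * q.[eta j].
  rewrite /q hornerD hornerN chebE mulrBr -exprMn mulrNN mulr1 expr1n subr_gt0.
  by rewrite (le_lt_trans (ler_norm _))// normrM normrX normrN1 expr1n mul1r p1.
have [r hr] : {r : nat -> R & forall j, (j < d.+1)%N -> eta j.+1 < r j < eta j /\ root q (r j)}.
  apply: (@choice _ _ (fun j z => (j < d.+1)%N -> eta j.+1 < z < eta j /\ root q z)) => j.
  have [jd|_] := ltnP j d.+1; last by exists 0.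
  have ejl : eta j.+1 <= eta j by apply/ltW/eta_lt.
  have s1 := qsgn j; have s2 := qsgn j.+1.
  have [||z z1 z2] := @poly_ivt _ ((-1) ^+ j *: q) (eta j.+1) (eta j).
  - by [].
  - rewrite !hornerZ (ltW s1) andbT.
    by move: s2; rewrite exprS mulN1r mulNr oppr_gt0 => /ltW.
  exists z => _; split; last first.
    by move: z2; rewrite rootZ// expf_eq0 oppr_eq0 oner_eq0 andbF.
  have zn i : (i = j \/ i = j.+1) -> z != eta i.
    move=> ij; apply: contraTneq z2 => ->; rewrite rootZ ?expf_eq0 ?oppr_eq0 ?oner_eq0 ?andbF//.
    by apply: contraTN (qsgn i) => /eqP ->; rewrite mulr0 ltxx.
  move: (zn j (or_introl erefl)) (zn j.+1 (or_intror erefl)) z1.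
  by move=> n1 n2 /andP[a b]; rewrite !lt_neqAle a b n1 eq_sym n2.
pose rs := mkseq r d.+1.
have r_lt i j : (i < j)%N -> (j < d.+1)%N -> r j < r i.
  move=> ij jd; have [/andP[_ a] _] := hr j jd.
  have [/andP[b _] _] := hr i (ltn_trans ij jd).
  apply: lt_trans a (le_lt_trans _ b).
  by move: ij; rewrite leq_eqVlt => /orP[/eqP <-//|ij]; apply/ltW/eta_lt => //; exact: ltnW.
have rs1 : {in rs, forall z : R, z < 1}.
  move=> z /mapP[j]; rewrite mem_iota add0n => /= jd ->.
  have [/andP[_ a] _] := hr j jd; apply: lt_le_trans a _.
  by case/andP: (eta_in j).
have q1 : 0 < q.[1] by have := qsgn 0%N; rewrite expr0 mul1r /eta mul0r cos0.
have q0 : q != 0 by apply: contraTneq q1 => ->; rewrite horner0 ltxx.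
have urs : uniq rs.
  apply/mkseq_uniqP => i j; rewrite !inE => id jd rij.
  have [ij|ij|//] := ltngtP i j.
    by have := r_lt _ _ ij jd; rewrite rij ltxx.
  by have := r_lt _ _ ij id; rewrite rij ltxx.
have ars : all (root q) rs.
  by apply/allP => z /mapP[j]; rewrite mem_iota add0n => /= jd ->; case: (hr j jd).
have sq : size q = (size rs).+1.
  apply/eqP; rewrite eqn_leq (max_poly_roots q0)// andbT size_mkseq.
  rewrite (leq_trans (size_polyD _ _))// geq_max size_polyN sp andbT.
  exact: size_cheb.
have := all_roots_prod_XsubC sq ars; rewrite uniq_rootsE => /(_ urs).
rewrite -/(prodL rs) => qE.
have lq : 0 < lead_coef q.
  by move: q1; rewrite {1}qE hornerZ pmulr_lgt0// prodL_gt0.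
have : 0 <= q^`().[1].
  rewrite qE derivZ hornerZ mulr_ge0 ?(ltW lq)// horner_deriv_prodL// => z /rs1.
  exact: ltW.
by rewrite /q derivB hornerD hornerN deriv_cheb1 subr_ge0.
Qed.

Lemma endpoint_markov (R : realType) (d : nat) (p : {poly R}) (B : R) :
  (size p <= d.+1)%N -> (forall t : R, -1 <= t <= 1 -> `|p.[t]| <= B) ->
  `|p^`().[1]| <= d%:R ^+ 2 * B.
Proof.
move=> sp pB.
have B0 : 0 <= B by apply: le_trans (pB 1 _); rewrite ?normr_ge0//; lra.
suff H (r : {poly R}) : (size r <= d.+1)%N -> (forall t : R, -1 <= t <= 1 -> `|r.[t]| <= B) ->
    r^`().[1] <= d%:R ^+ 2 * B.
  rewrite ler_norml H// andbT lerNl -hornerN -derivN; apply: H.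
    by rewrite size_polyN.
  by move=> t /pB; rewrite hornerN normrN.
move=> {p sp pB} sr rB; apply/ler_addgt0Pr => e e0.
(* Dividing by [B + e'] makes the bound strict, even when [B = 0]. The denominator is positive also
   for [d = 0], and the excess [d^2 * e'] is at most [e]. *)
pose e' := e / (d%:R ^+ 2 + 1).
have d0 : 0 < d%:R ^+ 2 + 1 :> R by rewrite ltr_wpDl// sqr_ge0.
have e'0 : 0 < e' by rewrite divr_gt0.
have Be : 0 < B + e' by rewrite ltr_wpDl.
have : ((B + e')^-1 *: r)^`().[1] <= d%:R ^+ 2.
  apply: endpoint_markov_lt1; first by rewrite (leq_trans (size_scale_leq _ _)).
  move=> t /rB h; rewrite hornerZ normrM gtr0_norm ?invr_gt0//.
  by rewrite mulrC ltr_pdivrMr// mul1r (le_lt_trans h)// ltrDl.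
rewrite derivZ hornerZ mulrC ler_pdivrMr// => /le_trans; apply.
rewrite mulrDr lerD2l /e' mulrCA ger_pMr// ler_pdivrMr// mul1r; lra.
Qed.

(** For z >= 0 the map [al] carries [-1, 1] onto [-1, z], which reduces the claim to the endpoint 1.
    Its slope (1 + z)/2 is at least 1/2, whence the factor 2. Negative points are handled by
    reflection. *)
Lemma markov (R : realType) (d : nat) (p : {poly R}) (B : R) :
  (size p <= d.+1)%N -> (forall t : R, -1 <= t <= 1 -> `|p.[t]| <= B) ->
  forall y : R, -1 <= y <= 1 -> `|p^`().[y]| <= 2 * d%:R ^+ 2 * B.
Proof.
move=> sp pB y y1.
have B0 : 0 <= B by apply: le_trans (pB 1 _); rewrite ?normr_ge0//; lra.
suff H (r : {poly R}) (z : R) : (size r <= d.+1)%N ->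
    (forall t : R, -1 <= t <= 1 -> `|r.[t]| <= B) -> 0 <= z <= 1 ->
    `|r^`().[z]| <= 2 * d%:R ^+ 2 * B.
  have [y0|y0] := leP 0 y; first by apply: H => //; lra.
  have := H (p \Po (- 'X)) (- y); rewrite deriv_comp derivN derivX.
  rewrite hornerM horner_comp !hornerN hornerX hornerC opprK mulrN1 normrN; apply.
  - by rewrite size_comp_poly2// size_polyN size_polyX.
  - by move=> t t1; rewrite horner_comp !hornerE; apply: pB; lra.
  - lra.
move=> {p sp pB y y1} sr rB z1.
pose al : {poly R} := ((1 + z) / 2) *: 'X + ((z - 1) / 2)%:P.
have := @endpoint_markov _ d (r \Po al) B.
have z0 : 0 < (1 + z) / 2 by lra.
have sal : size al = 2%N.
  by rewrite /al size_polyDl size_scale ?size_polyX ?gt_eqF// (leq_ltn_trans (size_polyC_leq1 _)).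
rewrite deriv_comp hornerM horner_comp size_comp_poly2//.
have -> : al.[1] = z by rewrite /al !hornerE; field.
have -> : al^`().[1] = (1 + z) / 2.
  by rewrite /al derivD derivZ derivX derivC !hornerE.
have rBa (t : R) : -1 <= t <= 1 -> `|(r \Po al).[t]| <= B.
  by move=> t1; rewrite horner_comp rB// /al !hornerE; nra.
move=> /(_ sr rBa); rewrite normrM (gtr0_norm z0).
have D0 : 0 <= d%:R ^+ 2 * B by rewrite mulr_ge0// sqr_ge0.
move: (normr_ge0 r^`().[z]); move: (`|_|) => N N0 h; nra.
Qed.

(** * Integrals of continuous functions *)

(** A real-valued integral. Most facts about it ask for continuity on the whole line, which settles
    integrability on every segment at once; the weight is extended accordingly in the final
    proof. *)
Definition RI (R : realType) (a b : R) (f : R -> R) : R :=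
  (\int[lebesgue_measure]_(t in `[a, b]) f t)%R.

Lemma continuous_integrable (R : realType) (a b : R) (f : R -> R) :
  continuous f -> lebesgue_measure.-integrable `[a, b] (EFin \o f).
Proof.
move=> cf; apply: continuous_compact_integrable; first exact: segment_compact.
exact: continuous_subspaceT.
Qed.

Lemma integral_RI (R : realType) (a b : R) (f : R -> R) : continuous f ->
  (\int[lebesgue_measure]_(t in `[a, b]) (f t)%:E = (RI a b f)%:E)%E.
Proof.
move=> cf; rewrite /RI /Rintegral fineK//.
exact: integrable_fin_num (continuous_integrable _ _ cf).
Qed.

Lemma RID (R : realType) (a b : R) (f g : R -> R) : continuous f -> continuous g ->
  RI a b (fun t => f t + g t) = RI a b f + RI a b g.
Proof. by move=> cf cg; rewrite /RI RintegralD//; exact: continuous_integrable. Qed.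

Lemma RIB (R : realType) (a b : R) (f g : R -> R) : continuous f -> continuous g ->
  RI a b (fun t => f t - g t) = RI a b f - RI a b g.
Proof. by move=> cf cg; rewrite /RI RintegralB//; exact: continuous_integrable. Qed.

Lemma RIZ (R : realType) (a b c : R) (f : R -> R) : continuous f ->
  RI a b (fun t => c * f t) = c * RI a b f.
Proof. by move=> cf; rewrite /RI RintegralZl//; exact: continuous_integrable. Qed.

Lemma eq_RI (R : realType) (a b : R) (f g : R -> R) :
  (forall t : R, a <= t <= b -> f t = g t) -> RI a b f = RI a b g.
Proof. by move=> fg; apply: eq_Rintegral => t; rewrite inE/= in_itv/=; exact: fg. Qed.

Lemma le_RI (R : realType) (a b : R) (f g : R -> R) : continuous f -> continuous g ->
  (forall t : R, a <= t <= b -> f t <= g t) -> RI a b f <= RI a b g.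
Proof.
move=> cf cg fg; rewrite /RI; apply: le_Rintegral => //; exact: continuous_integrable.
Qed.

Lemma RI_ge0 (R : realType) (a b : R) (f : R -> R) :
  (forall t : R, a <= t <= b -> 0 <= f t) -> 0 <= RI a b f.
Proof. by move=> f0; apply: Rintegral_ge0 => t /=; rewrite in_itv/=; exact: f0. Qed.

Lemma RI_cst (R : realType) (a b c : R) : a <= b -> RI a b (fun=> c) = c * (b - a).
Proof.
move=> ab; rewrite /RI Rintegral_cst//= lebesgue_measure_itv/= lte_fin.
by case: ltP => [_|ba]; rewrite ?EFinN -?EFinB//= (@le_anti _ _ a b) ?ab// subrr.
Qed.

Lemma RI_split (R : realType) (a c b : R) (f : R -> R) : continuous f ->
  a <= c <= b -> RI a b f = RI a c f + RI c b f.
Proof.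
move=> cf /andP[ac cb]; apply/eqP; rewrite addrC -subr_eq; apply/eqP.
rewrite /RI; have -> := @Rintegral_itvB R f (BLeft a) (BRight b) c (continuous_integrable a b cf).
- apply: Rintegral_itv_obnd_cbnd.
  apply: integrableS (continuous_integrable c b cf) => //.
  exact: subset_itv_oc_cc.
- by rewrite bnd_simp.
- by rewrite bnd_simp.
Qed.

Lemma RI_affine (R : realType) (a b k c : R) (g : R -> R) : continuous g -> 0 < k ->
  a <= b -> k * RI a b (fun t => g (k * t + c)) = RI (k * a + c) (k * b + c) g.
Proof.
move=> cg k0 ab; pose F (t : R) := k * t + c.
have dF (t : R) : is_derive t 1 F k.
  rewrite /F; apply: is_derive_eq; by rewrite addr0 scaler1/=.
have F' : derive1 F = fun=> k by apply/funext => t; rewrite derive1E; apply: derive_val.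
have cF : continuous F.
  by move=> t; apply: differentiable_continuous; exact/derivable1_diffP.
have cgF : continuous (fun t => g (F t)).
  by move=> t; apply: continuous_comp; [exact: cF|exact: cg].
rewrite /RI -RintegralZl//; last exact: continuous_integrable.
rewrite /Rintegral; congr fine; apply/esym.
have -> : k * a + c = F a by [].
have -> : k * b + c = F b by [].
rewrite (@integration_by_substitution_increasing _ F g a b)//.
- by apply: eq_integral => t _; rewrite F' /= mulrC.
- by move=> s t _ _ st; rewrite /F ltrD2r ltr_pM2l.
- by rewrite F' => t _; exact: cvg_cst.
- by rewrite F'; exact: is_cvg_cst.
- by rewrite F'; exact: is_cvg_cst.
- split=> [t _||]; first exact: ex_derive.
  + by apply: cvg_at_right_filter; exact: cF.
  + by apply: cvg_at_left_filter; exact: cF.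
- exact: continuous_subspaceT.
Qed.

Lemma RI_derive (R : realType) (a x : R) (f : R -> R) : continuous f -> a < x ->
  is_derive x 1 (RI a ^~ f) (f x).
Proof.
move=> cf ax.
(* The upper end [x + 1] makes [x] an interior point. *)
have [] := @continuous_FTC1_closed R f a x (x + 1) _ (continuous_integrable _ _ cf) ax (cf x).
  by rewrite ltrDl.
by move=> h1 h2; apply: is_derive_eq (derivableP h1) _; rewrite -derive1E.
Qed.

Lemma RI_FTC2 (R : realType) (a b : R) (F f : R -> R) : continuous f -> a < b ->
  (forall t : R, a <= t <= b -> is_derive t 1 F (f t)) -> RI a b f = F b - F a.
Proof.
move=> cf ab dF.
have cF (t : R) : a <= t <= b -> {for t, continuous F}.
  by move=> /dF h; apply: differentiable_continuous; exact/derivable1_diffP.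
rewrite /RI /Rintegral (@continuous_FTC2 _ f F)//; first exact: continuous_subspaceT.
- split=> [t||].
  + by rewrite in_itv/= => /andP[/ltW at_ /ltW tb]; have := dF t; rewrite at_ tb => /(_ isT).
  + by apply: cvg_at_right_filter; apply: cF; rewrite lexx ltW.
  + by apply: cvg_at_left_filter; apply: cF; rewrite lexx ltW.
- move=> t; rewrite in_itv/= => /andP[/ltW at_ /ltW tb].
  by rewrite derive1E; have := dF t; rewrite at_ tb => /(_ isT) h; apply: derive_val.
Qed.

(** * Canonical quadrature *)

Definition lagrange_poly (R : realType) (s : seq R) (z : R) : {poly R} :=
  \prod_(y <- [seq y <- s | y != z]) ((z - y)^-1 *: ('X - y%:P)).

Lemma lagrange_polyE (R : realType) (s : seq R) (z u : R) : u \in s ->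
  (lagrange_poly s z).[u] = (u == z)%:R.
Proof.
move=> us; rewrite /lagrange_poly horner_prod; have [->|uz] := eqVneq u z.
  rewrite big_seq big1// => y; rewrite mem_filter => /andP[yz _].
  by rewrite !hornerE mulVf// subr_eq0 eq_sym.
apply/eqP; rewrite prodf_seq_eq0; apply/hasP; exists u; first by rewrite mem_filter uz.
by rewrite /= !hornerE subrr mulr0.
Qed.

Lemma size_lagrange_poly (R : realType) (s : seq R) (z : R) : z \in s -> uniq s ->
  (size (lagrange_poly s z) <= size s)%N.
Proof.
move=> zs us; have -> : size s = (size [seq y <- s | y != z]).+1.
  by rewrite -rem_filter// size_rem//; case: s zs {us}.
rewrite /lagrange_poly; elim: [seq y <- s | y != z] => [|y r IH].
  by rewrite big_nil size_poly1.
rewrite big_cons (leq_trans (size_polyMleq _ _))//.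
have := size_scale_leq (z - y)^-1 ('X - y%:P); rewrite size_XsubC.
move=> h; rewrite -subn1 leq_subLR /=.
exact: (leq_trans (leq_add h IH)).
Qed.

Lemma lagrange_interpolation (R : realType) (s : seq R) (p : {poly R}) :
  uniq s -> (size p <= size s)%N -> p = \sum_(z <- s) p.[z] *: lagrange_poly s z.
Proof.
move=> us sp; apply/eqP; rewrite -subr_eq0; apply/eqP.
apply: (@roots_geq_poly_eq0 _ _ s) => //.
  apply/allP => u us'; rewrite /root hornerD hornerN horner_sum subr_eq0; apply/eqP.
  rewrite (bigD1_seq u)//= hornerZ lagrange_polyE// eqxx mulr1.
  rewrite big_seq_cond big1 ?addr0// => z /andP[zs zu].
  by rewrite hornerZ lagrange_polyE// eq_sym (negbTE zu) mulr0.
rewrite (leq_trans (size_polyD _ _))// geq_max sp size_polyN.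
rewrite big_seq; apply: (big_ind (fun q : {poly R} => size q <= size s)%N).
- by rewrite size_poly0.
- by move=> q r sq sr; rewrite (leq_trans (size_polyD _ _))// geq_max sq.
- by move=> z zs; rewrite (leq_trans (size_scale_leq _ _))// size_lagrange_poly.
Qed.

(** What the quadrature needs from integration against [w]. The last clause gives positivity on
    polynomials of size at most [N], and also bounds the competitors in the minimisation, which
    makes it a compact problem. *)
Definition coercive_functional (R : realType) (N : nat) (K : R) (L : {poly R} -> R) :=
  [/\ 0 < K, forall p q : {poly R}, L (p + q) = L p + L q,
    forall (c : R) (p : {poly R}), L (c *: p) = c * L p &
    forall p : {poly R}, (size p <= N)%N -> (forall t : R, -1 <= t <= 1 -> 0 <= p.[t]) ->
      forall t : R, -1 <= t <= 1 -> p.[t] <= K * L p].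

Lemma functional_ge0 (R : realType) N (K : R) L (p : {poly R}) :
  coercive_functional N K L -> (size p <= N)%N ->
  (forall t : R, -1 <= t <= 1 -> 0 <= p.[t]) -> 0 <= L p.
Proof.
case=> K0 _ _ h sp pp; rewrite -(pmulr_rge0 _ K0).
have i0 : -1 <= (0 : R) <= 1 by lra.
exact: le_trans (pp 0 i0) (h p sp pp 0 i0).
Qed.

Lemma functional_sum (R : realType) N (K : R) L (s : seq R) (F : R -> {poly R}) :
  coercive_functional N K L -> L (\sum_(z <- s) F z) = \sum_(z <- s) L (F z).
Proof.
case=> _ LD LZ _; apply: big_morph => //.
by rewrite -(scale0r (0 : {poly R})) LZ mul0r.
Qed.

Lemma linear_form_continuous (R : realType) (n : nat) (c : 'I_n -> R) :
  continuous (fun v : 'rV[R]_n => \sum_i v ord0 i * c i : R).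
Proof.
have -> : (fun v : 'rV[R]_n => \sum_i v ord0 i * c i : R) =
    \sum_i (fun v : 'rV[R]_n => v ord0 i * c i : R).
  by apply/funext => v; rewrite fct_sumE.
apply: (big_ind (fun f : 'rV[R]_n -> R => continuous f)) => [|f g cf cg|i _].
- exact: (@cst_continuous 'rV[R]_n R 0).
- by move=> v; exact: (cvgD (cf v) (cg v)).
- move=> v; have h := @coord_continuous R _ _ ord0 i v.
  exact: (cvgMr_tmp h).
Qed.

(** Compactness: a polynomial of size at most [N] is determined by its values at [N] distinct points
    of [-1, 1], so the competitors form a closed subset of R^N, on which [L] is linear. *)
Lemma exists_minimal_poly (R : realType) (N : nat) (K : R) L (x : R) :
  (0 < N)%N -> coercive_functional N K L -> -1 <= x <= 1 ->
  exists p : {poly R}, [/\ (size p <= N)%N, forall t : R, -1 <= t <= 1 -> 0 <= p.[t],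
    p.[x] = 1 &
    forall q : {poly R}, (size q <= N)%N -> (forall t : R, -1 <= t <= 1 -> 0 <= q.[t]) ->
      q.[x] = 1 -> L p <= L q].
Proof.
move=> N0 hL x1; have [K0 LD LZ LK] := hL.
pose s := mkseq (fun i => i%:R / N%:R : R) N.
have Npos : 0 < N%:R :> R by rewrite ltr0n.
have us : uniq s.
  apply/mkseq_uniqP => i j _ _ /mulIf h; apply/eqP; rewrite -(eqr_nat R).
  by apply/eqP/h; rewrite invr_eq0 gt_eqF.
have sz : size s = N by rewrite size_mkseq.
have s1 z : z \in s -> -1 <= z <= 1.
  move=> /mapP[i]; rewrite mem_iota add0n => /= iN ->.
  rewrite (@le_trans _ _ 0) ?divr_ge0//=.
  by rewrite ler_pdivrMr// mul1r ler_nat ltnW.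
pose l (i : 'I_N) := lagrange_poly s s`_i.
pose P (v : 'rV[R]_N) := \sum_i v ord0 i *: l i.
have sP v : (size (P v) <= N)%N.
  apply: (big_ind (fun q : {poly R} => size q <= N)%N).
  - by rewrite size_poly0.
  - by move=> q r sq sr; rewrite (leq_trans (size_polyD _ _))// geq_max sq.
  - move=> i _; rewrite (leq_trans (size_scale_leq _ _))// -sz size_lagrange_poly//.
    by rewrite mem_nth// sz.
have PE v t : (P v).[t] = \sum_i v ord0 i * (l i).[t].
  by rewrite horner_sum; apply: eq_bigr => i _; rewrite hornerZ.
have LP v : L (P v) = \sum_i v ord0 i * L (l i).
  rewrite (big_morph L (id1 := 0) (op1 := +%R)) => [|//|]; last first.
    by rewrite -(scale0r (0 : {poly R})) LZ mul0r.
  by apply: eq_bigr => i _; rewrite LZ.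
have surj (q : {poly R}) : (size q <= N)%N -> P (\row_i q.[s`_i]) = q.
  move=> sq; rewrite [RHS](lagrange_interpolation us) ?sz// (big_nth 0) sz big_mkord.
  by apply: eq_bigr => i _; rewrite mxE.
(* By coercivity this box contains every competitor with [L q <= L 1]; the remaining ones are beaten
   by the constant 1. *)
pose box := [set v : 'rV[R]_N | forall i, `[0, K * L 1]%classic (v ord0 i)].
pose A := box `&` ((\bigcap_(t in `[-1, 1]%classic) ((fun v => (P v).[t]) @^-1` [set y | 0 <= y]))
   `&` (fun v => (P v).[x]) @^-1` [set 1]).
have cP t : continuous (fun v => (P v).[t]).
  by under eq_fun do rewrite PE; exact: linear_form_continuous.
have cA : compact A.
  apply: compact_closedI; first apply: (@rV_compact R N (fun=> `[0, K * L 1]%classic)) => i.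
    exact: segment_compact.
  apply: closedI.
    apply: closed_bigI => t _.
    apply: (@preimage_closed _ R (fun v => (P v).[t]) [set y | 0 <= y]); last exact: closed_ge.
    by move=> v _; exact: cP.
  apply: (@preimage_closed _ R (fun v => (P v).[x]) [set 1]); last exact: closed_eq.
  by move=> v _; exact: cP.
have s1' : (size (1%R : {poly R}) <= N)%N by rewrite size_poly1.
have inA (q : {poly R}) : (size q <= N)%N -> (forall t : R, -1 <= t <= 1 -> 0 <= q.[t]) ->
    q.[x] = 1 -> L q <= L 1 -> A (\row_i q.[s`_i]).
  move=> sq q0 qx Lq; split=> [i|].
    rewrite /= in_itv/= mxE q0/=; last by apply: s1; rewrite mem_nth// sz.
    rewrite (le_trans (LK q sq q0 _ _))//; last by rewrite ler_pM2l.
    by apply: s1; rewrite mem_nth// sz.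
  split=> [t /=|/=]; last by rewrite surj.
  by rewrite in_itv/= surj//; exact: q0.
have A0 : A !=set0.
  by exists (\row_i (1 : {poly R}).[s`_i]); apply: inA; rewrite ?hornerC// => t _; rewrite hornerC.
have cLP : {within A, continuous (fun v => L (P v))}.
  apply: continuous_subspaceT; under eq_fun do rewrite LP.
  exact: linear_form_continuous.
have [v vA vmin] := compact_EVT_min A0 cA cLP.
move: vA; rewrite inE => -[_ [vp vx]].
exists (P v); split=> // q sq q0 qx.
have [Lq|/ltW Lq] := leP (L q) (L 1).
  rewrite -[in leRHS](surj q)//; apply: vmin; rewrite inE; exact: inA.
apply: le_trans Lq; rewrite -[in leRHS](surj 1)//; apply: vmin; rewrite inE.
by apply: inA; rewrite ?hornerC// => t _; rewrite hornerC.
Qed.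

(* Away from the zeros of [p] a multiple of [p] makes up for the negative part of
   [f]; near them [f >= - e] by continuity. *)
Lemma nonneg_perturbation (R : realType) (p f : {poly R}) (e : R) : 0 < e ->
  (forall t : R, -1 <= t <= 1 -> 0 <= p.[t]) ->
  (forall z : R, -1 <= z <= 1 -> root p z -> 0 <= f.[z]) ->
  exists C : R, forall t : R, -1 <= t <= 1 -> 0 <= (f + e%:P + C *: p).[t].
Proof.
move=> e0 pp fz; pose A := `[-1, 1]%classic `&` ((horner f) @^-1` [set y | y <= - e]).
have cA : compact A.
  apply: compact_closedI; first exact: segment_compact.
  apply: preimage_closed; last exact: closed_le.
  by move=> t _; exact: continuous_horner.
have [A0|/set0P/negP/negPn/eqP A0] := pselect (A !=set0); last first.
  exists 0 => t t1; rewrite scale0r addr0 hornerD hornerC.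
  suff : - e <= f.[t] by lra.
  rewrite leNgt; apply/negP => ft.
  have : A t by split; rewrite /= ?in_itv//=; exact: ltW.
  by rewrite A0.
have [c cA' cmin] := compact_EVT_min A0 cA (continuous_subspaceT (@continuous_horner R p)).
move: cA'; rewrite inE => -[/=]; rewrite in_itv/= => c1 fc.
have pc : 0 < p.[c].
  rewrite lt_neqAle pp// andbT eq_sym; apply/negP => pc0.
  by have := fz c c1 pc0; lra.
have [ub hub] := poly_itv_bound f (-1) 1.
have ub0 : 0 <= ub by apply: le_trans (hub c c1); exact: normr_ge0.
exists (ub / p.[c]) => t t1; rewrite !hornerE.
have h0 : 0 <= ub / p.[c] by rewrite divr_ge0// ltW.
have [ft|ft] := leP f.[t] (- e); last first.
  have : 0 <= ub / p.[c] * p.[t] by rewrite mulr_ge0// pp.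
  lra.
have /cmin pt : t \in A by rewrite inE; split; rewrite /= ?in_itv.
have : ub <= ub / p.[c] * p.[t] by rewrite mulrAC ler_pdivlMr// ler_wpM2l.
have := ler_norm (- f.[t]); rewrite normrN; have := hub t t1; lra.
Qed.

(** The formula comes from duality. By minimality of [p], the functional [L' q = L q - L p * q(x)]
    is nonnegative on nonnegative polynomials, and it kills [p]. Hence [L' f] depends only on the
    values of [f] at the zeros of [p], and is a nonnegative combination of them; the atom of mass
    [L p] at [x] is then added back. *)
Lemma canonical_quadrature (R : realType) (N : nat) (K : R) L (x : R) :
  (0 < N)%N -> coercive_functional N K L -> -1 < x < 1 ->
  exists (s : seq R) (wt : R -> R) (Pp Pm : {poly R}),
    [/\ uniq s /\ {in s, forall z : R, -1 <= z <= 1 /\ 0 <= wt z},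
      forall p : {poly R}, (size p <= N)%N -> L p = \sum_(z <- s) wt z * p.[z],
      (size Pp <= N)%N /\ (size Pm <= N)%N,
      forall t : R, -1 <= t <= 1 -> (t <= x)%R%:R <= Pp.[t] /\ Pm.[t] <= (t < x)%R%:R &
      {in s, forall z : R, Pp.[z] = (z <= x)%R%:R /\ Pm.[z] = (z < x)%R%:R}].
Proof.
move=> N0 hL x1.
have x1' : -1 <= x <= 1 by lra.
have [p [sp pp px pmin]] := exists_minimal_poly N0 hL x1'.
have [K0 LD LZ LK] := hL.
pose L' (q : {poly R}) := L q - L p * q.[x].
have L'pos (q : {poly R}) : (size q <= N)%N ->
    (forall t : R, -1 <= t <= 1 -> 0 <= q.[t]) -> 0 <= L' q.
  move=> sq q0; rewrite subr_ge0.
  have [qx|qx] := eqVneq q.[x] 0.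
    by rewrite qx mulr0; exact: functional_ge0 hL sq q0.
  have qx0 : 0 < q.[x] by rewrite lt_neqAle eq_sym qx q0.
  rewrite -ler_pdivlMr// mulrC -LZ; apply: pmin.
  - by rewrite (leq_trans (size_scale_leq _ _)).
  - by move=> t t1; rewrite hornerZ mulr_ge0 ?q0// invr_ge0 ltW.
  - by rewrite hornerZ mulVf.
have L'p : L' p = 0 by rewrite /L' px mulr1 subrr.
(* Adding a multiple of [p] does not change [L'], and the remaining shift [e'] is arbitrarily small,
   so it suffices that [f] be nonnegative at the zeros of [p]. *)
have L'soft (f : {poly R}) : (size f <= N)%N ->
    (forall z : R, -1 <= z <= 1 -> root p z -> 0 <= f.[z]) -> 0 <= L' f.
  move=> sf fz; apply/ler_addgt0Pr => e e0.
  have L10 : 0 <= L' 1.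
    by apply: L'pos => [|t _]; rewrite ?size_poly1// hornerC.
  pose e' := e / (L' 1 + 1).
  have e'0 : 0 < e' by rewrite divr_gt0// ltr_wpDl.
  have [C hC] := nonneg_perturbation e'0 pp fz.
  have : 0 <= L' (f + e'%:P + C *: p).
    apply: L'pos => //; rewrite (leq_trans (size_polyD _ _))// geq_max.
    rewrite (leq_trans (size_scale_leq _ _))// andbT (leq_trans (size_polyD _ _))//.
    by rewrite geq_max sf (leq_trans (size_polyC_leq1 _)).
  have -> : L' (f + e'%:P + C *: p) = L' f + e' * L' 1 + C * L' p.
    rewrite /L' !LD LZ -[e'%:P]mulr1 mul_polyC LZ !hornerD !hornerZ hornerC; ring.
  rewrite L'p mulr0 addr0 => /le_trans; apply; rewrite lerD2l.
  rewrite /e' mulrAC ler_pdivrMr ?ltr_wpDl// ler_pM2l//; lra.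
have px0 : p.[x] != 0 by rewrite px oner_eq0.
have [a [b [ha hb sab hab hr]]] := nonneg_poly_nodes x1 px0 pp.
have abx z : z \in a ++ b -> -1 <= z <= 1 /\ z != x.
  rewrite mem_cat => /orP[/ha|/hb] h; (split; first by lra).
    by rewrite lt_eqF//; case/andP: h.
  by rewrite gt_eqF//; case/andP: h.
pose s0 := undup (a ++ b).
have us0 : uniq s0 by exact: undup_uniq.
have ss0 : (size s0 < N)%N.
  by rewrite (leq_ltn_trans (size_undup _))// size_cat (leq_trans sab).
pose lam z := L' (lagrange_poly s0 z).
have lam0 z : z \in s0 -> 0 <= lam z.
  move=> zs; apply: L'soft.
    by rewrite (leq_trans (size_lagrange_poly zs us0))// ltnW.
  by move=> u u1 /(hr _ u1) us; rewrite lagrange_polyE ?ler0n// mem_undup.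
(* Both differences vanish at the zeros of [p], so [L'soft] applies to each of them. *)
have L'ext (f g : {poly R}) : (size f <= N)%N -> (size g <= N)%N ->
    {in s0, forall z : R, f.[z] = g.[z]} -> L' f = L' g.
  move=> sf sg fg.
  have H (u v : {poly R}) : (size u <= N)%N -> (size v <= N)%N ->
      {in s0, forall z : R, u.[z] = v.[z]} -> L' u <= L' v.
    move=> su sv uv; rewrite -subr_ge0.
    have -> : L' v - L' u = L' (v - u).
      have e : v - u = v + (-1) *: u by rewrite scaleN1r.
      by rewrite /L' e LD LZ hornerD hornerZ; ring.
    apply: L'soft.
      by rewrite (leq_trans (size_polyD _ _))// geq_max sv size_polyN.
    move=> z z1 /(hr _ z1) zs; rewrite hornerD hornerN uv ?subrr//.
    by rewrite mem_undup.
  by apply/eqP; rewrite eq_le !H// => z zs; rewrite fg.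
have L'E (f : {poly R}) : (size f <= N)%N -> L' f = \sum_(z <- s0) lam z * f.[z].
  move=> sf; pose g := \sum_(z <- s0) f.[z] *: lagrange_poly s0 z.
  have gE z : z \in s0 -> g.[z] = f.[z].
    move=> zs; rewrite horner_sum (bigD1_seq z)//= hornerZ lagrange_polyE// eqxx mulr1.
    rewrite big_seq_cond big1 ?addr0// => u /andP[us uz].
    by rewrite hornerZ lagrange_polyE// eq_sym (negbTE uz) mulr0.
  have sg : (size g <= N)%N.
    rewrite /g big_seq; apply: (big_ind (fun q : {poly R} => size q <= N)%N).
    - by rewrite size_poly0.
    - by move=> q r sq sr; rewrite (leq_trans (size_polyD _ _))// geq_max sq.
    - move=> z zs; rewrite (leq_trans (size_scale_leq _ _))//.
      by rewrite (leq_trans (size_lagrange_poly zs us0))// ltnW.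
  rewrite (L'ext f g)//; last by move=> z /gE.
  rewrite /L' /g (functional_sum _ _ hL) horner_sum mulr_sumr -sumrB.
  by apply: eq_bigr => z _; rewrite LZ hornerZ /lam /L'; ring.
have xs0 : x \notin s0 by rewrite mem_undup; apply/negP => /abx[_]; rewrite eqxx.
pose s := x :: s0; pose wt z := if z == x then L p else lam z.
have LE (f : {poly R}) : (size f <= N)%N -> L f = \sum_(z <- s) wt z * f.[z].
  move=> sf; rewrite big_cons /wt eqxx.
  rewrite (eq_big_seq (fun z => lam z * f.[z])); last first.
    by move=> z zs; case: eqP => // zx; rewrite zx (negbTE xs0) in zs.
  by rewrite -L'E// /L' addrC subrK.
have a_lt z : z \in a -> z < x by move=> /ha /andP[].
have b_gt z : z \in b -> x < z by move=> /hb /andP[].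
(* The node [x] joins the left group for the majorant and the right group for the minorant; among
   the nodes, the two interpolants differ at [x] only. *)
have [|//|U1 [V1 [e1 sU1 sV1 U1p V1p]]] := @bezout_nodes R (x :: a) b.
  by move=> y z; rewrite inE => /orP[/eqP ->|/a_lt yx] /b_gt // xz; exact: lt_trans xz.
have [||U2 [V2 [e2 sU2 sV2 U2p V2p]]] := @bezout_nodes R a (x :: b).
- by move=> y z /a_lt yx; rewrite inE => /orP[/eqP ->//|/b_gt]; exact: lt_trans.
- by rewrite /= addnS.
(* The Bezout identity writes each interpolant also as 1 minus a product. This form decides the
   comparison with 1 on the left of [x], the product form the comparison with 0 on the right. *)
have ev1 t : (prodR b * U1).[t] = 1 - (t - x) * (prodL a).[t] * V1.[t].
  have := congr1 (fun q : {poly R} => q.[t]) e1.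
  rewrite [prodL (x :: a)]/prodL big_cons hornerD hornerC -/(prodL a) => <-.
  by rewrite !hornerE; ring.
have ev2 t : (prodR (x :: b) * U2).[t] = 1 - (prodL a).[t] * V2.[t].
  have := congr1 (fun q : {poly R} => q.[t]) e2.
  by rewrite hornerD hornerC => <-; rewrite !hornerE; ring.
have ev2' t : (prodR (x :: b) * U2).[t] = (x - t) * (prodR b).[t] * U2.[t].
  by rewrite /prodR big_cons !hornerE.
exists s, wt, (prodR b * U1), (prodR (x :: b) * U2); split=> //.
- split; first by rewrite /= xs0.
  move=> z; rewrite inE => /orP[/eqP ->|zs].
    split; [lra|rewrite /wt eqxx; exact: functional_ge0 hL sp pp].
  have [z1 zx] := abx z (etrans (esym (mem_undup _ _)) zs).
  by split=> //; rewrite /wt (negbTE zx) lam0.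
(* The strict inequality pays for the extra simple node [x]. *)
- have hs : (size a + size b < N)%N by rewrite (leq_trans sab).
  split; rewrite (leq_trans (size_polyMleq _ _))// size_prodR.
  + by rewrite addSn /= (leq_trans _ hs)// addnC -addSn leq_add2r.
  + by rewrite !addSn /= (leq_trans _ hs)// ltnS addnC leq_add2r.
- move=> t t1; have [At Bt] := hab t t1; split.
  + have [tx|tx] := leP t x.
      rewrite ev1; have : 0 <= V1.[t] by apply: V1p => z /b_gt xz; apply/ltW/(le_lt_trans tx).
      move=> Vt; have -> : 1 - (t - x) * (prodL a).[t] * V1.[t] =
        1 + (x - t) * (prodL a).[t] * V1.[t] by ring.
      rewrite lerDl.
      by rewrite !mulr_ge0// subr_ge0.
    rewrite hornerM mulr_ge0// U1p// => y; rewrite inE => /orP[/eqP->|/a_lt yx]; first exact: ltW.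
    by rewrite ltW// (lt_trans yx).
  + have [tx|tx] := ltP t x.
      rewrite ev2; have : 0 <= V2.[t].
        apply: V2p => z; rewrite inE => /orP[/eqP->|/b_gt xz]; first exact: ltW.
        by rewrite ltW// (lt_trans tx).
      by move=> Vt; rewrite gerBl mulr_ge0.
    rewrite ev2'; have : 0 <= U2.[t] by apply: U2p => z /a_lt zx; apply/ltW/(lt_le_trans zx).
    by move=> Ut; rewrite -oppr_ge0 -!mulNr opprB !mulr_ge0// subr_ge0.
- have Lz z : z \in a -> (prodL a).[z] = 0.
    move=> za; rewrite prodLE; apply/eqP; rewrite prodf_seq_eq0; apply/hasP.
    by exists z => //=; rewrite subrr.
  have Rz z : z \in b -> (prodR b).[z] = 0.
    move=> za; rewrite prodRE; apply/eqP; rewrite prodf_seq_eq0; apply/hasP.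
    by exists z => //=; rewrite subrr.
  move=> z; rewrite inE mem_undup mem_cat => /orP[/eqP ->|/orP[za|zb]].
  + by rewrite lexx ltxx ev1 ev2' !subrr !mul0r subr0.
  + by rewrite ltW ?a_lt// ev1 ev2 Lz// mulr0 !mul0r subr0.
  + rewrite (lt_geF (b_gt _ zb)) (le_gtF (ltW (b_gt _ zb))).
    by rewrite hornerM Rz// ev2' Rz// mulr0 !mul0r.
Qed.

(** * Atomic measures and Nikolskii's inequality *)

(** The absolute value supplies the nonnegative number that [mscale] expects; on the nodes of the
    quadrature the weights are nonnegative already. *)
Definition atoms (R : realType) (s : seq R) (wt : R -> R) : {measure set R -> \bar R} :=
  msum (fun k => mscale (`|wt s`_k|%:nng) (dirac s`_k) : {measure set R -> \bar R}) (size s).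

Lemma atomsE (R : realType) (s : seq R) (wt : R -> R) (A : set R) :
  atoms s wt A = (\sum_(z <- s) `|wt z| * \1_A z)%:E.
Proof.
rewrite /atoms /= /msum (big_nth 0) big_mkord -sumEFin.
by apply: eq_bigr => i _; rewrite /= /mscale /= diracE indicE EFinM.
Qed.

Lemma ge0_integral_atoms (R : realType) (s : seq R) (wt : R -> R) (D : set R) (f : R -> R) :
  measurable D -> measurable_fun D f -> (forall t : R, D t -> 0 <= f t) ->
  (\int[atoms s wt]_(t in D) (f t)%:E = (\sum_(z <- s) `|wt z| * (\1_D z * f z))%:E)%E.
Proof.
move=> mD mf f0.
have /measurable_EFinP mEf := mf.
have Ef0 (t : R) : D t -> (0 <= (f t)%:E)%E by move=> Dt; rewrite lee_fin f0.
rewrite /atoms ge0_integral_measure_sum// (big_nth 0) big_mkord -sumEFin.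
apply: eq_bigr => i _.
by rewrite ge0_integral_mscale// integral_dirac// diracE indicE !EFinM.
Qed.

Lemma integral_atoms (R : realType) (s : seq R) (wt : R -> R) (D : set R) (f : R -> R) :
  measurable D -> measurable_fun D f ->
  (\int[atoms s wt]_(t in D) (f t)%:E = (\sum_(z <- s) `|wt z| * (\1_D z * f z))%:E)%E.
Proof.
move=> mD mf; rewrite integralE.
have mp : measurable_fun D (fun t : R => Num.max (f t) 0).
  have : measurable_fun D (f \max cst 0)%R.
    by apply: measurable_maxr => //; exact: measurable_cst.
  by [].
have mn : measurable_fun D (fun t : R => Num.max (- f t) 0).
  have : measurable_fun D ((fun t => - f t) \max cst 0)%R.
    apply: measurable_maxr; last exact: measurable_cst.
    by apply: measurableT_comp.
  by [].
have -> : (\int[atoms s wt]_(t in D) (fun t => (f t)%:E)^\+%E t =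
    \int[atoms s wt]_(t in D) (Num.max (f t) 0)%:E)%E.
  by apply: eq_integral => t _; rewrite unlock EFin_max.
have -> : (\int[atoms s wt]_(t in D) (fun t => (f t)%:E)^\-%E t =
    \int[atoms s wt]_(t in D) (Num.max (- f t) 0)%:E)%E.
  by apply: eq_integral => t _; rewrite unlock EFin_max.
rewrite !ge0_integral_atoms//; try by move=> t _; rewrite le_max lexx orbT.
rewrite -EFinB -sumrB; congr EFin; apply: eq_bigr => z _.
by rewrite -!mulrBr; congr (_ * (_ * _)); rewrite /Num.max; case: ltP => h1; case: ltP => h2; lra.
Qed.

Lemma poly_lipschitz (R : realType) (p : {poly R}) (D : R) :
  (forall t : R, -1 <= t <= 1 -> `|p^`().[t]| <= D) ->
  forall s t : R, -1 <= s <= 1 -> -1 <= t <= 1 -> `|p.[s] - p.[t]| <= D * `|s - t|.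
Proof.
move=> pD.
have H s t : -1 <= s <= 1 -> -1 <= t <= 1 -> s <= t -> `|p.[s] - p.[t]| <= D * `|s - t|.
  move=> s1 t1 st.
  have [|c] := @MVT_segment R (horner p) (fun u => p^`().[u]) s t st
    (fun u _ => is_derive_poly p u).
    exact: continuous_subspaceT (@continuous_horner R p).
  rewrite in_itv/= => cst e; rewrite distrC e normrM (distrC s).
  by rewrite ler_wpM2r// pD//; lra.
move=> s t s1 t1; have [st|/ltW ts] := leP s t; first exact: H.
by rewrite distrC (distrC s); exact: H.
Qed.

(** Let [B] be the maximum, taken at [c]. By [markov] with degree 2n the derivative is at most 8n^2
    B, so p >= B/2 within distance 1/(16n^2) of [c]. An interval of that length on one side of [c]
    lies in [-1, 1] and contributes B/(32n^2) to the integral. *)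
Lemma nikolskii (R : realType) (n : nat) (p : {poly R}) : (0 < n)%N ->
  (size p <= 2 * n)%N -> (forall t : R, -1 <= t <= 1 -> 0 <= p.[t]) ->
  forall t : R, -1 <= t <= 1 -> p.[t] <= 32 * n%:R ^+ 2 * RI (-1) 1 (horner p).
Proof.
move=> n0 sp pp t t1.
have cp := @continuous_horner R p.
have nn : 1 <= n%:R :> R by rewrite ler1n.
have [|c] := @EVT_max R (horner p) (-1) 1 _ (continuous_subspaceT cp); first lra.
rewrite in_itv/= => c1 cmax.
have pB (u : R) : -1 <= u <= 1 -> `|p.[u]| <= p.[c].
  by move=> u1; rewrite ger0_norm ?pp// cmax// in_itv.
apply: le_trans (cmax t _) _; first by rewrite in_itv.
have B0 := pp c c1; set B := p.[c] in B0 pB *.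
have pL (u : R) : -1 <= u <= 1 -> `|p^`().[u]| <= 8 * n%:R ^+ 2 * B.
  move=> u1; apply: le_trans (@markov R (2 * n) p B _ pB u u1) _; first by rewrite leqW.
  by rewrite natrM exprMn; lra.
set h : R := (16 * n%:R ^+ 2)^-1.
have hE : 16 * n%:R ^+ 2 * h = 1 by rewrite divff// mulf_neq0// expf_eq0/= gt_eqF//; lra.
have nn2 : 1 <= n%:R ^+ 2 :> R by rewrite exprn_ege1.
have h0 : 0 < h by rewrite invr_gt0; lra.
have h1 : h <= 1 by rewrite invf_le1; lra.
have low (u : R) : -1 <= u <= 1 -> `|c - u| <= h -> B / 2 <= p.[u].
  move=> u1 ch; have := poly_lipschitz pL c1 u1.
  have : 8 * n%:R ^+ 2 * B * `|c - u| <= B / 2.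
    apply: le_trans (_ : 8 * n%:R ^+ 2 * B * h <= _).
      by rewrite ler_wpM2l// !mulr_ge0//; lra.
    have -> : 8 * n%:R ^+ 2 * B * h = (16 * n%:R ^+ 2 * h) * B / 2 by field.
    by rewrite hE mul1r.
  by rewrite -/B; have := ler_norm (B - p.[u]); lra.
have [u [v [uv1 uv2 uvc]]] : exists u v : R, [/\ -1 <= u, v <= 1 & v - u = h /\
    forall z : R, u <= z <= v -> `|c - z| <= h].
  have [c0|c0] := leP c 0.
    exists c, (c + h); split; [lra|lra|split; first lra] => z zz.
    by rewrite ler_norml; lra.
  exists (c - h), c; split; [lra|lra|split; first lra] => z zz.
  by rewrite ler_norml; lra.
have [huv uvc'] := uvc.
have I1 : B / 2 * h <= RI (-1) 1 (horner p).
  rewrite (@RI_split R (-1) u 1)//; last by lra.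
  rewrite (@RI_split R u v 1)//; last by lra.
  have : 0 <= RI (-1) u (horner p) by apply: RI_ge0 => z zz; apply: pp; lra.
  have : 0 <= RI v 1 (horner p) by apply: RI_ge0 => z zz; apply: pp; lra.
  have : RI u v (fun=> B / 2) <= RI u v (horner p).
    apply: le_RI => //; first by move=> z; exact: cvg_cst.
    by move=> z zz; apply: low; [lra|exact: uvc'].
  rewrite RI_cst; last by lra.
  by rewrite huv; lra.
apply: le_trans (_ : 32 * n%:R ^+ 2 * (B / 2 * h) <= _); last first.
  by rewrite ler_wpM2l//; lra.
have -> : 32 * n%:R ^+ 2 * (B / 2 * h) = (16 * n%:R ^+ 2 * h) * B by field.
by rewrite hE mul1r.
Qed.

(** * Extremal values of measures *)

Definition wfun (R : realType) (w : R -> R) (p : {poly R}) : R :=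
  RI (-1) 1 (fun t => p.[t] * w t).

Lemma continuous_mul (R : realType) (f g : R -> R) :
  continuous f -> continuous g -> continuous (fun t => f t * g t).
Proof. by move=> cf cg t; apply: cvgM; [exact: cf|exact: cg]. Qed.

Lemma continuous_poly_mul (R : realType) (w : R -> R) (p : {poly R}) :
  continuous w -> continuous (fun t => p.[t] * w t).
Proof. exact: continuous_mul (@continuous_horner R p). Qed.

Lemma wfun_coercive (R : realType) (w : R -> R) (m : R) (n : nat) :
  continuous w -> 0 < m -> (forall t : R, -1 <= t <= 1 -> m <= w t) -> (0 < n)%N ->
  coercive_functional (2 * n) (32 * n%:R ^+ 2 / m) (wfun w).
Proof.
move=> cw m0 wm n0; have nn : 0 < n%:R :> R by rewrite ltr0n.
have cpw (p : {poly R}) := @continuous_poly_mul R w p cw.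
split.
- by rewrite divr_gt0// mulr_gt0// exprn_gt0.
- by move=> p q; rewrite /wfun -RID//; apply: eq_RI => t _; rewrite hornerD mulrDl.
- by move=> c p; rewrite /wfun -RIZ//; apply: eq_RI => t _; rewrite hornerZ mulrA.
- move=> p sp pp t t1; apply: le_trans (nikolskii n0 sp pp t1) _.
  rewrite -[leRHS]mulrA ler_wpM2l ?mulr_ge0 ?exprn_ge0 ?ler0n//.
  rewrite ler_pdivlMl// -RIZ; last exact: continuous_horner.
  apply: le_RI => [||u u1]; [|exact: cpw|].
    by apply: continuous_mul; [move=> ?; exact: cvg_cst|exact: continuous_horner].
  by rewrite mulrC ler_wpM2l ?pp// wm.
Qed.

(** Allows [w], which is arbitrary outside [-1, 1], to be replaced by a continuous extension. *)
Lemma quad_measures_ext (R : realType) (n : nat) (w w' : R -> R) :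
  (forall t : R, -1 <= t <= 1 -> w t = w' t) -> quad_measures n w = quad_measures n w'.
Proof.
move=> ww; rewrite /quad_measures; apply/seteqP.
split=> mu [mu0 h]; split=> // p sp; rewrite h//; apply: eq_integral => t;
  rewrite inE/= in_itv/= => t1; by rewrite ww.
Qed.

Lemma quad_measuresE (R : realType) (n : nat) (w : R -> R) (mu : {measure set R -> \bar R})
    (p : {poly R}) : continuous w -> quad_measures n w mu -> (size p <= 2 * n)%N ->
  (\int[mu]_(t in `[(-1)%R, 1%R]) (p.[t])%:E = (wfun w p)%:E)%E.
Proof.
move=> cw [_ h] sp; rewrite h// integral_RI//.
exact: (@continuous_poly_mul R w p cw).
Qed.

Lemma measurable_horner (R : realType) (p : {poly R}) (D : set R) :
  measurable D -> measurable_fun D (horner p).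
Proof.
move=> mD; apply: measurable_funTS; apply: continuous_measurable_fun.
exact: continuous_horner.
Qed.

Lemma quad_measures_le (R : realType) (n : nat) (w : R -> R) (mu : {measure set R -> \bar R})
    (p : {poly R}) (A : set R) : continuous w -> quad_measures n w mu ->
  measurable A -> A `<=` `[-1, 1] -> (size p <= 2 * n)%N ->
  (forall t : R, -1 <= t <= 1 -> \1_A t <= p.[t]) ->
  (mu A <= (wfun w p)%:E)%E.
Proof.
move=> cw muM mA A1 sp pA; rewrite -(quad_measuresE cw muM sp).
have -> : mu A = (\int[mu]_(t in `[(-1)%R, 1%R]) (\1_A t)%:E)%E.
  by rewrite integral_indic//; congr (mu _); apply/esym/classical_sets.setIidPl.
apply: ge0_le_integral => //=.
- by apply/measurable_EFinP; exact: measurable_funTS.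
- by apply/measurable_EFinP; exact: measurable_horner.
Qed.

(** The quadrature is itself a member of the class, as the measure [atoms s wt]. It gives [-1, x]
    the mass [wfun w Pp], which no member can exceed because [Pp] is a majorant, and it gives the
    point [x] the mass [wfun w Pp - wfun w Pm]. *)
Lemma extremal_polys (R : realType) (w : R -> R) (m : R) (n : nat) (x : R) :
  continuous w -> 0 < m -> (forall t : R, -1 <= t <= 1 -> m <= w t) -> (0 < n)%N ->
  -1 < x < 1 ->
  exists Pp Pm : {poly R},
    [/\ (size Pp <= 2 * n)%N /\ (size Pm <= 2 * n)%N,
      forall t : R, -1 <= t <= 1 -> (t <= x)%R%:R <= Pp.[t] /\ Pm.[t] <= (t < x)%R%:R,
      pi_fun n w x = wfun w Pp,
      wfun w Pp - wfun w Pm <= lambda_fun n w x &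
      forall p : {poly R}, (size p <= 2 * n)%N ->
        (forall t : R, -1 <= t <= 1 -> (t <= x)%R%:R <= p.[t]) -> pi_fun n w x <= wfun w p].
Proof.
move=> cw m0 wm n0 x1; have hL := wfun_coercive cw m0 wm n0.
have n20 : (0 < 2 * n)%N by rewrite muln_gt0.
have [s [wt [Pp [Pm [[us hs] LE [sPp sPm] hP hN]]]]] := canonical_quadrature n20 hL x1.
pose mu := atoms s wt.
have s1 z : z \in s -> -1 <= z <= 1 by move=> /hs[].
have wt0 z : z \in s -> `|wt z| = wt z by move=> /hs[_]; exact: ger0_norm.
have muM : quad_measures n w mu.
  split.
    rewrite atomsE big_seq big1// => z zs; rewrite indicE memNset ?mulr0//=.
    by apply; rewrite /= in_itv/= s1.
  move=> p sp; rewrite integral_atoms//; last exact: measurable_horner.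
  rewrite integral_RI; last exact: continuous_poly_mul.
  rewrite -/(wfun w p) LE//; congr EFin; apply: eq_big_seq => z zs.
  by rewrite wt0// indicE mem_set ?mul1r//= in_itv/= s1.
have xI : `[-1, x]%classic `<=` `[-1, 1]%classic.
  by move=> t /=; rewrite !in_itv/=; lra.
have xI1 : [set x] `<=` `[-1, 1]%classic.
  by move=> t /= ->; rewrite !in_itv/=; lra.
have mu_pi : mu `[-1, x]%classic = (wfun w Pp)%:E.
  rewrite atomsE LE//; congr EFin; apply: eq_big_seq => z zs.
  have [-> _] := hN z zs; rewrite wt0//; congr (_ * _).
  have z1 := s1 z zs; rewrite indicE; congr (_%:R).
  by congr nat_of_bool; apply/idP/idP; rewrite inE/= in_itv/=; lra.
have mu_lam : mu [set x] = (wfun w Pp - wfun w Pm)%:E.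
  rewrite atomsE !LE// -sumrB; congr EFin; apply: eq_big_seq => z zs.
  have [-> ->] := hN z zs; rewrite wt0// -mulrBr; congr (_ * _).
  rewrite indicE; have [->|zx] := eqVneq z x; first by rewrite mem_set// lexx ltxx subr0.
  by rewrite memNset /= ?le_eqVlt ?(negbTE zx) ?subrr//; exact/eqP.
have pi_le nu (p : {poly R}) : quad_measures n w nu -> (size p <= 2 * n)%N ->
    (forall t : R, -1 <= t <= 1 -> (t <= x)%R%:R <= p.[t]) ->
    (nu `[(-1)%R, x]%classic <= (wfun w p)%:E)%E.
  move=> nuM sp hp; apply: (quad_measures_le cw nuM) => // t t1.
  apply: le_trans (hp t t1); rewrite indicE.
  case: (boolP (t \in _)) => [|_]; last by rewrite ler0n.
  by rewrite inE/= in_itv/= => /andP[_ ->].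
have pi_sup : ereal_sup [set nu `[-1, x]%classic | nu in quad_measures n w] = (wfun w Pp)%:E.
  apply/eqP; rewrite eq_le; apply/andP; split.
    by apply: ge_ereal_sup => _ [nu nuM <-]; apply: pi_le => // t /hP[].
  by apply: ereal_sup_ubound; exists mu.
exists Pp, Pm; split=> //.
- by rewrite /pi_fun pi_sup.
- have h1 : ((wfun w Pp - wfun w Pm)%:E <=
      ereal_sup [set nu [set x] | nu in quad_measures n w])%E.
    by apply: ereal_sup_ubound; exists mu.
  (* Finiteness matters here: [fine] would send an infinite supremum to 0. *)
  have h2 : (ereal_sup [set nu [set x] | nu in quad_measures n w] <= (wfun w 1)%:E)%E.
    apply: ge_ereal_sup => _ [nu nuM <-]; apply: (quad_measures_le cw nuM) => //.
      by rewrite size_poly1.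
    by move=> t _; rewrite hornerC indicE; case: (_ \in _).
  rewrite /lambda_fun; move: h1 h2; case: (ereal_sup _) => [r| |] h1 h2.
  + by rewrite lee_fin in h1.
  + by [].
  + by [].
- move=> p sp hp; rewrite -lee_fin {1}/pi_fun pi_sup -mu_pi; exact: pi_le.
Qed.

(** * Dilations *)

Lemma derive1_ge_right (R : realType) (f : R -> R) (x c e : R) : 0 < e ->
  derivable f x 1 -> (forall h : R, 0 < h < e -> c * h <= f (x + h) - f x) ->
  c <= derive1 f x.
Proof.
move=> e0 df fc; have dE : h^-1 *: (f (h + x) - f x) @[h --> 0^'] --> derive1 f x.
  by rewrite derive1E; move: df; rewrite /derivable /derive; under eq_fun do rewrite /= scaler1.
apply: (cvgr_to_ge (cvg_dnbhs_at_right dE)).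
near=> h; have h0 : 0 < h by near: h; exact: nbhs_right_gt.
rewrite -[_ *: _]/(_ * _) mulrC ler_pdivlMr// (addrC h) fc// h0/=.
by near: h; exact: nbhs_right_lt.
Unshelve. all: by end_near. Qed.

Lemma derive1_le_right (R : realType) (f : R -> R) (x c e : R) : 0 < e ->
  derivable f x 1 -> (forall h : R, 0 < h < e -> f (x + h) - f x <= c * h) ->
  derive1 f x <= c.
Proof.
move=> e0 df fc; have dE : h^-1 *: (f (h + x) - f x) @[h --> 0^'] --> derive1 f x.
  by rewrite derive1E; move: df; rewrite /derivable /derive; under eq_fun do rewrite /= scaler1.
apply: (cvgr_to_le (cvg_dnbhs_at_right dE)).
near=> h; have h0 : 0 < h by near: h; exact: nbhs_right_gt.
rewrite -[_ *: _]/(_ * _) mulrC ler_pdivrMr// (addrC h) fc// h0/=.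
by near: h; exact: nbhs_right_lt.
Unshelve. all: by end_near. Qed.

Lemma derive1_le_left (R : realType) (f : R -> R) (x c e : R) : 0 < e ->
  derivable f x 1 -> (forall h : R, 0 < h < e -> f x - f (x - h) <= c * h) ->
  derive1 f x <= c.
Proof.
move=> e0 df fc; have dE : h^-1 *: (f (h + x) - f x) @[h --> 0^'] --> derive1 f x.
  by rewrite derive1E; move: df; rewrite /derivable /derive; under eq_fun do rewrite /= scaler1.
apply: (cvgr_to_le (cvg_dnbhs_at_left dE)).
near=> h; have h0 : h < 0 by near: h; exact: nbhs_left_lt.
rewrite -[_ *: _]/(_ * _) mulrC ler_ndivrMr// (addrC h).
have he : - h < e by rewrite ltrNl; near: h; apply: nbhs_left_gt; rewrite oppr_lt0.
by have := fc (- h); rewrite opprK oppr_gt0 h0 he => /(_ isT); lra.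
Unshelve. all: by end_near. Qed.

Lemma gap_bounds (R : realType) (w : R -> R) (m : R) (n : nat) (x : R) :
  continuous w -> 0 < m -> (forall t : R, -1 <= t <= 1 -> m <= w t) -> (0 < n)%N ->
  -1 < x < 1 ->
  0 <= pi_fun n w x - RI (-1) x w <= lambda_fun n w x.
Proof.
move=> cw m0 wm n0 x1.
have [Pp [Pm [[sPp sPm] hP piE lamE _]]] := extremal_polys cw m0 wm n0 x1.
have w0 (t : R) : -1 <= t <= 1 -> 0 <= w t by move=> /wm; lra.
have cp := @continuous_poly_mul R w Pp cw.
have cm := @continuous_poly_mul R w Pm cw.
have c0 : continuous (fun _ : R => 0 : R) by move=> ?; exact: cvg_cst.
have hp : RI (-1) x w <= wfun w Pp.
  rewrite /wfun (@RI_split R (-1) x 1)//; last lra.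
  have : RI (-1) x w <= RI (-1) x (fun t => Pp.[t] * w t).
    apply: le_RI => // t tx; have t1 : -1 <= t <= 1 by lra.
    rewrite ler_peMl ?w0//; have [h _] := hP t t1.
    by apply: le_trans h; case/andP: tx => _ ->.
  have : 0 <= RI x 1 (fun t => Pp.[t] * w t).
    apply: RI_ge0 => t tx; have t1 : -1 <= t <= 1 by lra.
    rewrite mulr_ge0 ?w0//; have [h _] := hP t t1.
    by apply: le_trans h; rewrite ler0n.
  lra.
have hm : wfun w Pm <= RI (-1) x w.
  rewrite /wfun (@RI_split R (-1) x 1)//; last lra.
  have : RI (-1) x (fun t => Pm.[t] * w t) <= RI (-1) x w.
    apply: le_RI => // t tx; have t1 : -1 <= t <= 1 by lra.
    rewrite ler_piMl ?w0//; have [_ h] := hP t t1.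
    by apply: le_trans h _; case: (t < x); rewrite ?ler01.
  have : RI x 1 (fun t => Pm.[t] * w t) <= RI x 1 (fun=> 0).
    apply: le_RI => // t tx; have t1 : -1 <= t <= 1 by lra.
    rewrite mulr_le0_ge0 ?w0//; have [_ h] := hP t t1.
    by apply: le_trans h _; rewrite ltNge; case/andP: tx => ->.
  rewrite RI_cst; lra.
rewrite piE; lra.
Qed.

Lemma affine_contraction (R : realType) (e s t : R) :
  -1 <= e <= 1 -> 0 < s < 1 -> -1 <= t <= 1 -> -1 <= s * t + (1 - s) * e <= 1.
Proof.
move=> e1 s1 t1.
have : 0 <= (1 - s) * (e + 1) by rewrite mulr_ge0//; lra.
have : 0 <= (1 - s) * (1 - e) by rewrite mulr_ge0//; lra.
have : 0 <= s * (t + 1) by rewrite mulr_ge0//; lra.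
have : 0 <= s * (1 - t) by rewrite mulr_ge0//; lra.
lra.
Qed.

(* An affine contraction [phi] of [-1, 1] carrying [x] to [y] turns a majorant of
   the indicator of [-1, y] into one of [-1, x], and [w] changes under [phi] by a
   factor [1 + O(1 - s)] only. *)
Lemma gap_dilation (R : realType) (w : R -> R) (m Rc : R) (n : nat) (x y e s : R) :
  continuous w -> 0 < m -> 0 < Rc -> (forall t : R, -1 <= t <= 1 -> m <= w t) ->
  (forall u v : R, -1 <= u <= 1 -> -1 <= v <= 1 -> `|w u - w v| <= Rc * `|u - v|) ->
  (0 < n)%N -> -1 < x < 1 -> -1 <= e <= 1 -> 0 < s < 1 ->
  y = e + s * (x - e) ->
  (1 - (1 + 2 * Rc / m) * (1 - s)) * (pi_fun n w x - RI (-1) x w) <=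
    pi_fun n w y - RI (-1) y w.
Proof.
move=> cw m0 Rc0 wm wL n0 x1 e1 s1 yE.
have y1 : -1 < y < 1.
  have : 0 <= (1 - s) * (e + 1) by rewrite mulr_ge0//; lra.
  have : 0 <= (1 - s) * (1 - e) by rewrite mulr_ge0//; lra.
  have : 0 < s * (x + 1) by rewrite mulr_gt0//; lra.
  have : 0 < s * (1 - x) by rewrite mulr_gt0//; lra.
  by rewrite yE; lra.
have s0 : 0 < s by case/andP: s1.
have s0' := ltW s0.
have [xL xR] : -1 <= x /\ x <= 1 by lra.
have [yL yR] : -1 <= y /\ y <= 1 by lra.
have x12 : -1 <= x <= 1 by rewrite xL.
have y12 : -1 <= y <= 1 by rewrite yL.
have [Pp [Pm [[sP _] hP piy _ _]]] := extremal_polys cw m0 wm n0 y1.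
have [_ [_ [_ _ _ _ pix]]] := extremal_polys cw m0 wm n0 x1.
have /andP[gx0 _] := gap_bounds cw m0 wm n0 x1.
set kap := 2 * Rc / m; have kap0 : 0 < kap by rewrite divr_gt0// mulr_gt0.
pose c := (1 - s) * e.
pose phi (t : R) := s * t + c.
have phi1 t : -1 <= t <= 1 -> -1 <= phi t <= 1.
  exact: affine_contraction.
have phix : phi x = y by rewrite yE /phi /c; ring.
pose Q : {poly R} := Pp \Po (s *: 'X + c%:P).
have QE t : Q.[t] = Pp.[phi t] by rewrite horner_comp !hornerE.
have sQ : (size Q <= 2 * n)%N.
  rewrite size_comp_poly2// size_polyDl size_scale ?size_polyX ?gt_eqF//.
  by rewrite (leq_ltn_trans (size_polyC_leq1 _)).
have w0 (t : R) : -1 <= t <= 1 -> 0 <= w t by move=> /wm; lra.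
pose K := 1 + kap * (1 - s).
have K0 : 0 <= K by rewrite /K; nra.
(* A point moves by at most 2(1 - s), so [w] changes by at most 2 Rc (1 - s) = kap (1 - s) m, which
   [m <= w] turns into a relative error. *)
have wphi t : -1 <= t <= 1 -> w t <= K * w (phi t).
  move=> t1; have := wL t (phi t) t1 (phi1 t t1).
  have : `|t - phi t| <= 2 * (1 - s).
    by rewrite /phi /c ler_norml; nra.
  have h1 := wm _ (phi1 t t1); have h2 := ler_norm (w t - w (phi t)) => h3 h4.
  have : Rc * `|t - phi t| <= Rc * (2 * (1 - s)) by rewrite ler_wpM2l// ltW.
  have : kap * (1 - s) * m <= kap * (1 - s) * w (phi t).
    by rewrite ler_wpM2l// mulr_ge0 ?(ltW kap0)//; lra.
  have -> : kap * (1 - s) * m = Rc * (2 * (1 - s)) by rewrite /kap; field; rewrite gt_eqF.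
  by rewrite /K; lra.
have cPw (p : {poly R}) := @continuous_poly_mul R w p cw.
have P1 t : -1 <= t <= y -> 0 <= Pp.[t] - 1.
  move=> ty; have [|h _] := hP t; first by lra.
  by rewrite subr_ge0; apply: le_trans h; case/andP: ty => _ ->.
have P0 t : -1 <= t <= 1 -> 0 <= Pp.[t].
  by move=> t1; have [h _] := hP t t1; apply: le_trans h; rewrite ler0n.
pose g1 (t : R) := (Pp - 1).[t] * w t.
pose g2 (t : R) := Pp.[t] * w t.
have cg1 : continuous g1 by exact: cPw.
have cg2 : continuous g2 by exact: cPw.
have cphi : continuous phi.
  have -> : phi = horner (s *: 'X + c%:P) by apply/funext => t; rewrite !hornerE.
  exact: continuous_horner.
have cgphi (g : R -> R) : continuous g -> continuous (fun t => g (phi t)).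
  by move=> cg t; exact: (@continuous_comp R R R phi g t (cphi t) (cg (phi t))).
(* For a majorant [p] both integrands on the right are nonnegative. Hence replacing [w] by the
   larger [K * (w o phi)], and after the change of variables enlarging the image of [-1, 1] to
   [-1, 1], can only increase the gap. *)
have gapE (p : {poly R}) (z : R) : -1 <= z <= 1 ->
    wfun w p - RI (-1) z w =
    RI (-1) z (fun t => (p - 1).[t] * w t) + RI z 1 (fun t => p.[t] * w t).
  move=> z1; rewrite /wfun (@RI_split R (-1) z 1)//.
  have -> : RI (-1) z (fun t => (p - 1).[t] * w t) =
      RI (-1) z (fun t => p.[t] * w t - w t).
    by apply: eq_RI => t _; rewrite !hornerE; ring.
  by rewrite RIB//; ring.
have scale (a b : R) (g : R -> R) : continuous g -> a <= b ->
    s * RI a b (fun t => g (phi t)) = RI (phi a) (phi b) g.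
  by move=> cg ab; rewrite /phi RI_affine.
have up : pi_fun n w x - RI (-1) x w <=
    RI (-1) x (fun t => (Q - 1).[t] * w t) + RI x 1 (fun t => Q.[t] * w t).
  rewrite -gapE//.
  rewrite lerD2r; apply: pix => // t t1.
  rewrite QE; have [h _] := hP (phi t) (phi1 t t1); apply: le_trans h.
  by rewrite -phix /phi lerD2r ler_pM2l.
have phm : -1 <= phi (-1) <= y.
  have /andP[-> _] : -1 <= phi (-1) <= 1 by apply: phi1; rewrite lexx; lra.
  by rewrite -phix /phi lerD2r ler_pM2l.
have php : y <= phi 1 <= 1.
  have /andP[_ ->] : -1 <= phi 1 <= 1 by apply: phi1; rewrite lexx; lra.
  by rewrite andbT -phix /phi lerD2r ler_pM2l.
have I1 : s * RI (-1) x (fun t => (Q - 1).[t] * w t) <= K * RI (-1) y g1.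
  apply: le_trans (_ : s * (K * RI (-1) x (fun t => g1 (phi t))) <= _).
    rewrite ler_wpM2l//.
    rewrite -RIZ; last exact: cgphi.
    apply: le_RI => [||t tx]; [exact: cPw| |].
      by apply: continuous_mul (cgphi _ cg1) => ?; exact: cvg_cst.
    have t1 : -1 <= t <= 1 by move/andP: tx => [-> /le_trans->].
    rewrite /g1 !hornerD !hornerN !hornerC QE [leRHS]mulrCA ler_wpM2l ?wphi// P1//.
    have /andP[-> _] := phi1 t t1; rewrite -phix /phi lerD2r ler_pM2l//.
    by case/andP: tx.
  rewrite mulrCA scale//.
  rewrite ler_wpM2l// phix (@RI_split R (-1) (phi (-1)) y)//.
  rewrite lerDr; apply: RI_ge0 => t ty; rewrite /g1 mulr_ge0//.
    by rewrite !hornerD !hornerN !hornerC P1//; lra.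
  by apply: w0; lra.
have I2 : s * RI x 1 (fun t => Q.[t] * w t) <= K * RI y 1 g2.
  apply: le_trans (_ : s * (K * RI x 1 (fun t => g2 (phi t))) <= _).
    rewrite ler_wpM2l//.
    rewrite -RIZ; last exact: cgphi.
    apply: le_RI => [||t tx]; [exact: cPw| |].
      by apply: continuous_mul (cgphi _ cg2) => ?; exact: cvg_cst.
    have t1 : -1 <= t <= 1 by move/andP: tx => [/(le_trans xL)-> ->].
    by rewrite /g2 QE [leRHS]mulrCA ler_wpM2l ?wphi// P0// phi1.
  rewrite mulrCA scale//.
  rewrite ler_wpM2l// phix (@RI_split R y (phi 1) 1)//.
  rewrite lerDl; apply: RI_ge0 => t ty; rewrite /g2 mulr_ge0//.
    by apply: P0; lra.
  by apply: w0; lra.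
have gy : pi_fun n w y - RI (-1) y w = RI (-1) y g1 + RI y 1 g2.
  by rewrite piy gapE.
have main : s * (pi_fun n w x - RI (-1) x w) <= K * (pi_fun n w y - RI (-1) y w).
  rewrite gy [leRHS]mulrDr; apply: le_trans (lerD I1 I2).
  rewrite -mulrDr ler_wpM2l//; by case/andP: s1 => /ltW.
move: gx0 main; set gx := pi_fun n w x - _; set gyv := pi_fun n w y - _ => gx0 main.
have Kpos : 0 < K by rewrite /K; nra.
rewrite -(ler_pM2l Kpos); apply: le_trans main; rewrite mulrA ler_wpM2r//.
(* With d = 1 - s this is the inequality (1 + kap d)(1 - (1 + kap) d) <= 1 - d. *)
rewrite -subr_ge0 (_ : _ - _ = kap * (1 + kap) * (1 - s) ^+ 2); last by rewrite /K; ring.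
by rewrite mulr_ge0 ?sqr_ge0// mulr_ge0 ?addr_ge0 ?(ltW kap0).
Qed.

(** * The endpoint regime *)

Lemma cheb_one_sub_bounds (R : realType) (n : nat) (t : R) :
  -1 <= t <= 1 -> 0 <= 1 - (cheb R n).[t] <= 2 * n%:R ^+ 2 * (1 - t).
Proof.
move=> t1; have := cheb_le1 n t1; rewrite ler_norml => /andP[h1 h2].
have t0 : -1 <= (1 : R) <= 1 by lra.
have mk (u : R) : -1 <= u <= 1 -> `|(cheb R n)^`().[u]| <= 2 * n%:R ^+ 2 * 1.
  by apply: markov (size_cheb R n) _ u => v v1; exact: cheb_le1.
have := poly_lipschitz mk t0 t1; rewrite cheb1 mulr1.
have : 0 <= 1 - t by lra.
by move=> /ger0_norm ->; have := ler_norm (1 - (cheb R n).[t]); lra.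
Qed.

(** The quotient (1 - T_n(t)) / (n^2 (1 - t)), with T_n the Chebyshev polynomial; for t = cos u it
    is a normalised Fejer kernel. Its value at 1 comes from T_n'(1) = n^2. *)
Lemma fejer_poly (R : realType) (n : nat) : (0 < n)%N ->
  exists q : {poly R}, [/\ (size q <= n)%N,
    forall t : R, n%:R ^+ 2 * (1 - t) * q.[t] = 1 - (cheb R n).[t],
    forall t : R, -1 <= t <= 1 -> 0 <= q.[t] <= 2 & q.[1] = 1].
Proof.
move=> n0; have nn : 0 < n%:R ^+ 2 :> R by rewrite exprn_gt0// ltr0n.
have /factor_theorem[q0 e] : root (cheb R n - 1) 1.
  by rewrite /root !hornerE cheb1 subrr.
pose q := n%:R ^- 2 *: q0.
have qE t : n%:R ^+ 2 * (1 - t) * q.[t] = 1 - (cheb R n).[t].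
  have h : (cheb R n).[t] - 1 = q0.[t] * (t - 1).
    have := congr1 (fun p : {poly R} => p.[t]) e.
    by rewrite hornerD hornerN hornerM hornerXsubC hornerC.
  rewrite /q hornerZ.
  have -> : n%:R ^+ 2 * (1 - t) * (n%:R ^- 2 * q0.[t]) =
      (n%:R ^+ 2 * n%:R ^- 2) * - (q0.[t] * (t - 1)) by ring.
  by rewrite divff ?gt_eqF// mul1r -h opprB.
have q1 : q.[1] = 1.
  have := congr1 (fun p : {poly R} => p^`().[1]) e.
  rewrite derivB derivC subr0 deriv_cheb1 derivM derivXsubC mulr1.
  rewrite hornerD hornerM hornerXsubC subrr mulr0 add0r.
  by rewrite /q hornerZ => <-; rewrite mulVf// gt_eqF.
have qlt t : -1 <= t <= 1 -> t != 1 -> 0 <= q.[t] <= 2.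
  move=> t1 tn; have t0 : 0 < 1 - t by rewrite subr_gt0 lt_neqAle tn; case/andP: t1.
  have := cheb_one_sub_bounds n t1; rewrite -qE => /andP[h1 h2].
  apply/andP; split; first by rewrite -(pmulr_rge0 _ (mulr_gt0 nn t0)).
  by rewrite -(ler_pM2l (mulr_gt0 nn t0)); lra.
exists q; split=> //.
- rewrite (leq_trans (size_scale_leq _ _))//.
  have [->|q00] := eqVneq q0 0; first by rewrite size_poly0.
  rewrite -ltnS.
  have -> : (size q0).+1 = size (cheb R n - 1).
    by rewrite e size_Mmonic ?monicXsubC// size_XsubC addn2.
  rewrite (leq_trans (size_polyD _ _))// geq_max size_cheb size_polyN size_poly1.
  by [].
- by move=> t t1; have [->|] := eqVneq t 1; [rewrite q1 ler01 ler1n|exact: qlt].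
Qed.

(** The polynomial is 4 q(-t)^2 with [q] from [fejer_poly]. Since |q'| <= 4n^2 by [markov], q(-t) >=
    1/2 as long as 8n^2(1 + t) <= 1, which is where the threshold 8 comes from. With y = n^2(1 + t),
    both q(-t) and y q(-t) lie in [0, 2], so the polynomial is at most 32/(1 + y^2), whose primitive
    is an arctangent; finally pi/2 < 2. *)
Lemma endpoint_majorant (R : realType) (n : nat) : (0 < n)%N ->
  exists p : {poly R}, [/\ (size p <= 2 * n)%N,
    forall t : R, -1 <= t <= 1 -> 0 <= p.[t],
    forall t : R, -1 <= t -> 8 * n%:R ^+ 2 * (1 + t) <= 1 -> 1 <= p.[t] &
    RI (-1) 1 (horner p) <= 64 / n%:R ^+ 2].
Proof.
move=> n0; have [q [sq qE q2 q1]] := fejer_poly R n0.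
have nn : 1 <= n%:R ^+ 2 :> R by rewrite exprn_ege1// ler1n.
pose p : {poly R} := 4 *: (q ^+ 2 \Po (- 'X)).
have pE t : p.[t] = 4 * q.[- t] ^+ 2.
  by rewrite hornerZ horner_comp hornerN hornerX horner_exp.
have mk (u : R) : -1 <= u <= 1 -> `|q^`().[u]| <= 4 * n%:R ^+ 2.
  move=> u1; have qb (t : R) : -1 <= t <= 1 -> `|q.[t]| <= 2.
    by move=> /q2 /andP[a b]; rewrite ger0_norm.
  by apply: le_trans (markov (leqW sq) qb u1) _; lra.
exists p; split.
- rewrite (leq_trans (size_scale_leq _ _))// size_comp_poly2 ?size_polyN ?size_polyX//.
  rewrite expr2 (leq_trans (size_polyMleq _ _))// (leq_trans (leq_pred _))//.
  by rewrite mul2n -addnn leq_add.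
- by move=> t _; rewrite pE mulr_ge0// sqr_ge0.
- move=> t t1 tn; have t2 : -1 <= - t <= 1 by nra.
  have t0 : -1 <= (1 : R) <= 1 by lra.
  have := poly_lipschitz mk t0 t2; rewrite q1 opprK (ger0_norm (_ : 0 <= 1 + t)); last by lra.
  have := ler_norm (1 - q.[- t]) => h1 h2.
  have h3 : 1 / 2 <= q.[- t] by lra.
  by rewrite pE expr2; nra.
- pose F (t : R) : R := 32 / n%:R ^+ 2 * atan (n%:R ^+ 2 * (1 + t)).
  pose f (t : R) : R := 32 * (1 + (n%:R ^+ 2 * (1 + t)) ^+ 2)^-1.
  have D1 (t : R) : 0 < 1 + (n%:R ^+ 2 * (1 + t)) ^+ 2.
    by rewrite ltr_pwDl// sqr_ge0.
  have cf : continuous f.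
    move=> t; apply: cvgM; first exact: cvg_cst.
    apply: cvgV; first by rewrite gt_eqF.
    have -> : (fun t : R => 1 + (n%:R ^+ 2 * (1 + t)) ^+ 2) =
        horner (1 + (n%:R ^+ 2 *: (1 + 'X)) ^+ 2).
      by apply/funext => u; rewrite !hornerE.
    have -> : 1 + (n%:R ^+ 2 * (1 + t)) ^+ 2 =
        (1 + (n%:R ^+ 2 *: (1 + 'X)) ^+ 2 : {poly R}).[t] by rewrite !hornerE.
    exact: continuous_horner.
  have dF (t : R) : is_derive t 1 F (f t).
    have da : is_derive t 1 (fun u : R => n%:R ^+ 2 * (1 + u)) (n%:R ^+ 2).
      by apply: is_derive_eq; rewrite add0r scaler1/=.
    have db := @is_derive1_comp R atan (fun u : R => n%:R ^+ 2 * (1 + u)) t _ _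
      (is_derive1_atan (n%:R ^+ 2 * (1 + t))) da.
    apply: is_derive_eq (is_deriveZ (32 / n%:R ^+ 2) db) _.
    have n20 : n%:R ^+ 2 != 0 :> R by rewrite gt_eqF//; lra.
    by rewrite /f -[_ *: _]/(_ * _) [X in _ * X]mulrC mulrA divfK.
  have -> : 64 / n%:R ^+ 2 = 32 / n%:R ^+ 2 * 2 :> R by ring.
  apply: le_trans (_ : RI (-1) 1 f <= _).
    apply: le_RI => // [|t t1]; first exact: continuous_horner.
    rewrite pE /f ler_pdivlMr//.
    have t2 : -1 <= - t <= 1 by lra.
    have /andP[a b] := q2 _ t2; have := qE (- t); rewrite opprK => e.
    have := cheb_le1 n t2; rewrite ler_norml => /andP[c1 c2].
    have A : 0 <= n%:R ^+ 2 * (1 + t) * q.[- t] <= 2 by rewrite e; lra.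
    have -> : 4 * q.[- t] ^+ 2 * (1 + (n%:R ^+ 2 * (1 + t)) ^+ 2) =
        4 * (q.[- t] ^+ 2 + (n%:R ^+ 2 * (1 + t) * q.[- t]) ^+ 2) by ring.
    have q4 : q.[- t] ^+ 2 <= 4 by rewrite expr2; nra.
    move: A; set z := n%:R ^+ 2 * _ * _ => /andP[z0 z2].
    have z4 : z ^+ 2 <= 4.
      rewrite -[4]/(2 * 2)%:R natrM -expr2 ler_sqr// nnegrE; lra.
    have -> : 32 = 4 * (4 + 4) :> R by ring.
    by rewrite ler_wpM2l// lerD.
  rewrite (@RI_FTC2 R (-1) 1 F f)//.
  rewrite /F subrr mulr0 atan0 mulr0 subr0 ler_wpM2l ?divr_ge0 ?sqr_ge0//.
  apply: ltW; apply: lt_trans (atan_ltpi2 _) _.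
  by have /andP[] := @pihalf_02 R.
Qed.

(** The increment is at most p0 a/(1 - a), and a/(1 - a) <= 2a for a < 1/2. *)
Lemma relative_increment_le (R : realType) (a p0 p1 : R) :
  0 < a -> a < 1 / 2 -> 0 <= p0 -> (1 - a) * p1 <= p0 -> p1 - p0 <= 2 * a * p0.
Proof.
move=> a0 a1 p00 h; have k0 : 0 < 1 - a by lra.
rewrite -(ler_pM2l k0) -subr_ge0.
have -> : (1 - a) * (2 * a * p0) - (1 - a) * (p1 - p0) =
    (p0 - (1 - a) * p1) + a * (1 - 2 * a) * p0 by ring.
rewrite addr_ge0 ?subr_ge0// mulr_ge0// mulr_ge0 ?(ltW a0)//; lra.
Qed.

(* Near [-1] the optimal majorant is bounded, so by [markov] it stays close to [1]
   slightly to the right of [x]. *)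
Lemma derive1_pi_endpoint (R : realType) (w : R -> R) (m M : R) (n : nat) (x : R) :
  continuous w -> 0 < m -> (forall t : R, -1 <= t <= 1 -> m <= w t <= M) -> (0 < n)%N ->
  -1 < x < 1 -> 8 * n%:R ^+ 2 * (1 + x) <= 1 -> derivable (pi_fun n w) x 1 ->
  derive1 (pi_fun n w) x <=
    16 * 32 * 64 * (M / m) * (1 + 4 * (M / m)) * n%:R ^+ 2 * lambda_fun n w x.
Proof.
move=> cw m0 wmM n0 x1 xn dpi.
have wm (t : R) : -1 <= t <= 1 -> m <= w t by move=> /wmM /andP[].
have wM (t : R) : -1 <= t <= 1 -> w t <= M by move=> /wmM /andP[].
have i0 : -1 <= (0 : R) <= 1 by lra.
have M0 : 0 < M by have := wmM _ i0; lra.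
set N : R := n%:R ^+ 2.
have nn : 1 <= N by rewrite exprn_ege1// ler1n.
have [K0 _ _ LK] := wfun_coercive cw m0 wm n0.
have [Pp [Pm [[sP sPm] hP piE lamE _]]] := extremal_polys cw m0 wm n0 x1.
have pi_min y : -1 < y < 1 -> forall p : {poly R}, (size p <= 2 * n)%N ->
    (forall t : R, -1 <= t <= 1 -> (t <= y)%R%:R <= p.[t]) -> pi_fun n w y <= wfun w p.
  by move=> y1; have [_ [_ [_ _ _ _ h]]] := extremal_polys cw m0 wm n0 y1.
have P0 t : -1 <= t <= 1 -> 0 <= Pp.[t].
  by move=> t1; have [h _] := hP t t1; apply: le_trans h; rewrite ler0n.
have x2 : -1 <= x <= 1 by lra.
have /andP[gap0 gap1] := gap_bounds cw m0 wm n0 x1.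
(* [Pp - Pm] is nonnegative on [-1, 1] and at least 1 at [x], so coercivity bounds its integral, and
   hence lambda, from below. *)
have lam_ge : 1 <= 32 * N / m * lambda_fun n w x.
  apply: le_trans (_ : 32 * N / m * (wfun w Pp - wfun w Pm) <= _); last first.
    by rewrite ler_wpM2l// ltW.
  have [h1 h2] := hP x x2; rewrite lexx in h1; rewrite ltxx in h2.
  have {}h1 : 1 <= Pp.[x] by [].
  have {}h2 : Pm.[x] <= 0 by [].
  have cPw (p : {poly R}) := @continuous_poly_mul R w p cw.
  have -> : wfun w Pp - wfun w Pm = wfun w (Pp - Pm).
    by rewrite /wfun -RIB//; apply: eq_RI => t _; rewrite hornerD hornerN; ring.
  apply: le_trans (LK _ _ _ x x2).
  - by rewrite hornerD hornerN; lra.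
  - by rewrite (leq_trans (size_polyD _ _))// geq_max sP size_polyN.
  - move=> t t1; have [k1 k2] := hP t t1; rewrite hornerD hornerN subr_ge0.
    apply: le_trans k2 (le_trans _ k1); rewrite ler_nat.
    by case: ltgtP.
have [T [sT T0 T1 IT]] := endpoint_majorant R n0.
have pi_up : pi_fun n w x <= M * (64 / N).
  apply: le_trans (pi_min x x1 T sT _) _.
    move=> t t1; have [tx|_] := leP t x; last exact: T0.
    apply: T1; first by case/andP: t1.
    by apply: le_trans xn; rewrite ler_wpM2l ?mulr_ge0 ?lerD2l//; lra.
  apply: le_trans (_ : M * RI (-1) 1 (horner T) <= _); last by rewrite ler_wpM2l// ltW.
  rewrite -RIZ; last exact: continuous_horner.
  apply: le_RI => [||t t1]; first exact: continuous_poly_mul.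
    by apply: continuous_mul (@continuous_horner R T) => ?; exact: cvg_cst.
  by rewrite mulrC ler_wpM2r ?T0// wM.
(* The coercivity constant 32 N / m times the bound 64 M / N on pi; the powers of n cancel. *)
set B := 32 * 64 * (M / m).
have B0 : 0 < B by rewrite mulr_gt0// divr_gt0.
have PB (t : R) : -1 <= t <= 1 -> `|Pp.[t]| <= B.
  move=> t1; rewrite ger0_norm ?P0//; apply: le_trans (LK _ sP P0 t t1) _.
  rewrite -piE; apply: le_trans (ler_wpM2l (ltW K0) pi_up) _.
  rewrite le_eqVlt; apply/orP; left; apply/eqP; rewrite /B -/N; field.
  by rewrite !gt_eqF//; lra.
have PD (t : R) : -1 <= t <= 1 -> `|Pp^`().[t]| <= 8 * N * B.
  move=> t1; apply: le_trans (markov (leqW sP) PB t1) _.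
  by rewrite natrM exprMn -/N; lra.
set D := 8 * N * B in PD.
have D0 : 0 < D by rewrite mulr_gt0//; lra.
have pi0 : 0 <= pi_fun n w x.
  have : 0 <= RI (-1) x w by apply: RI_ge0 => t tx; have := wm t; lra.
  lra.
(* The gap is at most lambda, and the remainder W <= M(1 + x) <= M/(8N) is absorbed by [lam_ge]. *)
have pi_lam : pi_fun n w x <= (1 + 4 * (M / m)) * lambda_fun n w x.
  have hW : RI (-1) x w <= M * (1 + x).
    apply: le_trans (_ : RI (-1) x (fun=> M) <= _).
      by apply: le_RI => // [?|t tx]; [exact: cvg_cst|apply: wM; lra].
    by rewrite RI_cst; lra.
  have hx : M * (1 + x) <= 4 * (M / m) * lambda_fun n w x.
    have h8 : M * (8 * N * (1 + x)) <= M * (32 * N / m * lambda_fun n w x).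
      by rewrite ler_pM2l//; apply: le_trans xn _.
    rewrite -(ler_pM2l (_ : 0 < 8 * N)); last by lra.
    apply: le_trans (le_trans _ h8) _; rewrite le_eqVlt; apply/orP; left; apply/eqP; first ring.
    by field; rewrite gt_eqF.
  lra.
have pos2 : 0 < 2 * D by lra.
apply: le_trans (_ : 2 * D * pi_fun n w x <= _); last first.
  apply: le_trans (ler_wpM2l (ltW pos2) pi_lam) _.
  by rewrite le_eqVlt; apply/orP; left; apply/eqP; rewrite /D /B; ring.
pose e := Num.min (1 - x) (2 * D)^-1.
have e0 : 0 < e by rewrite lt_min invr_gt0 pos2 andbT; lra.
apply: (derive1_le_right e0 dpi) => h; rewrite lt_min => /andP[h0 /andP[h1 h2]].
have Dh : D * h < 1 / 2.
  have : 2 * D * h < 1 by rewrite mulrC -ltr_pdivlMr// mul1r.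
  lra.
have Dh0 : 0 < D * h by rewrite mulr_gt0.
(* [Pp] loses at most [D * h] between [x] and [x + h], so dividing it by [1 - D * h] gives a
   majorant for the point [x + h]. *)
have step : (1 - D * h) * pi_fun n w (x + h) <= pi_fun n w x.
  have k0 : 0 < 1 - D * h by lra.
  have -> : pi_fun n w x = (1 - D * h) * wfun w ((1 - D * h)^-1 *: Pp).
    have -> : wfun w ((1 - D * h)^-1 *: Pp) = (1 - D * h)^-1 * wfun w Pp.
      rewrite /wfun -RIZ; last exact: continuous_poly_mul.
      by apply: eq_RI => t _; rewrite hornerZ mulrA.
    by rewrite mulrA divff ?gt_eqF// mul1r.
  rewrite ler_pM2l//; apply: pi_min; first by lra.
    by rewrite (leq_trans (size_scale_leq _ _)).
  move=> t t1; rewrite hornerZ mulrC ler_pdivlMr//.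
  have [txh|_] := leP t (x + h); last by rewrite mul0r P0.
  rewrite mul1r; have [tx|tx] := leP t x.
    have [h3 _] := hP t t1; rewrite tx in h3; have {}h3 : 1 <= Pp.[t] by []; lra.
  have [h3 _] := hP x x2; rewrite lexx in h3; have {}h3 : 1 <= Pp.[x] by [].
  have := poly_lipschitz PD x2 t1.
  have : D * `|x - t| <= D * h.
    rewrite ler_pM2l// distrC gtr0_norm ?subr_gt0//.
    by rewrite lerBlDr addrC.
  have := ler_norm (Pp.[x] - Pp.[t]); lra.
have := relative_increment_le Dh0 Dh pi0 step.
by move/le_trans; apply; rewrite le_eqVlt; apply/orP; left; apply/eqP; ring.
Qed.

(** * Extension of the weight to the line, and combination of the two regimes *)

Theorem theorem1p1 (R : realType) (w : R -> R) (m Rc : R) :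
  0 < m -> 0 < Rc ->
  (forall x, -1 <= x <= 1 -> m <= w x) ->
  (forall x y, -1 <= x -> x < y -> y <= 1 -> `|w x - w y| <= Rc * (y - x)) ->
  exists C : R, 0 < C /\
    forall (n : nat) (x : R), (1 <= n)%N -> -1 < x < 1 ->
      derivable (pi_fun n w) x 1 ->
      - C * lambda_fun n w x / (1 - x) <= derive1 (pi_fun n w) x - w x /\
      derive1 (pi_fun n w) x - w x
        <= C * lambda_fun n w x * Num.min (1 / (1 + x)) (n%:R ^+ 2).
Proof.
move=> m0 Rc0 wm0 wL0.
(* Clamping to [-1, 1] extends [w] to a Lipschitz, hence continuous, function on the line with the
   same values on [-1, 1]. *)
pose cl (t : R) := Num.max (-1) (Num.min 1 t).
pose wb t := w (cl t).
have clE t : -1 <= t <= 1 -> cl t = t.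
  by move=> /andP[a b]; rewrite /cl min_r// max_r.
have cl1 t : -1 <= cl t <= 1.
  by rewrite /cl le_max lexx /= ge_max ge_min lexx andbT; lra.
have wbE t : -1 <= t <= 1 -> wb t = w t by move=> t1; rewrite /wb clE.
have wL (u v : R) : -1 <= u <= 1 -> -1 <= v <= 1 -> `|w u - w v| <= Rc * `|u - v|.
  move=> /andP[u1 u2] /andP[v1 v2]; have [uv|uv|->] := ltgtP u v.
  - by have := wL0 u v u1 uv v2; rewrite -(gtr0_norm (_ : 0 < v - u)) ?subr_gt0// (distrC v).
  - have := wL0 v u v1 uv u2.
    by rewrite -(gtr0_norm (_ : 0 < u - v)) ?subr_gt0// normr_id (distrC (w v)).
  - by rewrite !subrr !normr0 mulr0.
have wm (t : R) : -1 <= t <= 1 -> m <= wb t by move=> _; exact: wm0 (cl1 t).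
have wbL (u v : R) : -1 <= u <= 1 -> -1 <= v <= 1 -> `|wb u - wb v| <= Rc * `|u - v|.
  by move=> u1 v1; rewrite !wbE//; exact: wL.
have clL (u v : R) : `|cl u - cl v| <= `|u - v|.
  have H (a b : R) : a <= b -> 0 <= cl b - cl a <= b - a.
    rewrite /cl /Num.max /Num.min => ab.
    by case: (ltP 1 a) => ?; case: (ltP 1 b) => ?; do 2![case: ltP => ?]; lra.
  have [/H|/ltW/H] := leP u v => /andP[h1 h2].
    by rewrite distrC (distrC u) !ger0_norm//; lra.
  by rewrite !ger0_norm//; lra.
have cw : continuous wb.
  move=> t; apply/cvgrPdist_lt => e e0.
  have eR : 0 < e / Rc by rewrite divr_gt0.
  have /cvgrPdist_lt/(_ _ eR) := @cvg_id _ (nbhs t); apply: filterS => u hu.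
  apply: le_lt_trans (wL _ _ (cl1 t) (cl1 u)) _.
  by rewrite mulrC -ltr_pdivlMr// (le_lt_trans (clL t u)).
pose M := wb 0 + Rc.
have wmM (t : R) : -1 <= t <= 1 -> m <= wb t <= M.
  move=> t1; rewrite wm//= /M; have i0 : -1 <= (0 : R) <= 1 by lra.
  have := wbL t 0 t1 i0; rewrite subr0; have := ler_norm (wb t - wb 0).
  have : Rc * `|t| <= Rc * 1 by rewrite ler_pM2l// ler_norml.
  lra.
have M0 : 0 < M.
  by have i0 : -1 <= (0 : R) <= 1 by [lra]; have := wmM 0 i0; lra.
pose k1 := 1 + 2 * Rc / m.
pose k2 := 16 * 32 * 64 * (M / m) * (1 + 4 * (M / m)).
have k10 : 0 < k1 by rewrite /k1 addr_gt0// divr_gt0// mulr_gt0.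
have k20 : 0 < k2.
  have q0 : 0 < M / m by rewrite divr_gt0.
  by rewrite /k2; apply: mulr_gt0; [rewrite mulr_gt0// !mulr_gt0//|lra].
(* [k1] comes from the contractions and [k2] from the endpoint regime; the 8 is the loss in
   replacing 1/(1 + x) by the minimum outside that regime. *)
exists (8 * k1 + k2); split; first lra.
move=> n x n0 x1.
have piE : pi_fun n w = pi_fun n wb.
  by apply/funext => y; rewrite /pi_fun (quad_measures_ext n (w' := wb))// => t /wbE.
have lamE : lambda_fun n w x = lambda_fun n wb x.
  by rewrite /lambda_fun (quad_measures_ext n (w' := wb))// => t /wbE.
have x2 : -1 <= x <= 1 by lra.
rewrite piE lamE -(wbE x x2) => dpi.
have /andP[gap0 gap1] := gap_bounds cw m0 wm n0 x1.
set lam := lambda_fun n wb x in gap1 *.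
pose gap y := pi_fun n wb y - RI (-1) y wb.
have lam0 : 0 <= lam by apply: le_trans gap1.
have x1' : -1 < x by case/andP: x1.
have dgap : is_derive x 1 gap (derive1 (pi_fun n wb) x - wb x).
  by apply: is_deriveB; [rewrite derive1E; exact: derivableP|exact: RI_derive].
have dgap' : derivable gap x 1 by exact: ex_derive.
have gapE : derive1 (pi_fun n wb) x - wb x = derive1 gap x.
  by rewrite (derive1E gap); apply/esym/derive_val.
have ex0 : 0 < 1 - x by lra.
have ex1 : 0 < 1 + x by lra.
(* The contraction with fixed point 1 and ratio s = 1 - h/(1 - x) sends [x] to [x + h]. For [upper],
   the fixed point -1 sends [x] to [x - h]. *)
have lower : - (k1 * gap x / (1 - x)) <= derive1 gap x.
  apply: (derive1_ge_right ex0 dgap') => h /andP[h0 h1].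
  have := @gap_dilation R wb m Rc n x (x + h) 1 (1 - h / (1 - x)) cw m0 Rc0 wm wbL n0 x1.
  rewrite -/(gap x) -/(gap (x + h)) -/k1 opprB addrCA subrr addr0.
  have hx : 0 < h / (1 - x) < 1 by rewrite divr_gt0//= ltr_pdivrMr// mul1r.
  have e1 : x + h = 1 + (1 - h / (1 - x)) * (x - 1) by field; rewrite gt_eqF.
  have i1 : -1 <= (1 : R) <= 1 by lra.
  have i2 : 0 < 1 - h / (1 - x) < 1 by lra.
  move=> /(_ i1 i2 e1).
  have -> : - (k1 * gap x / (1 - x)) * h = - (k1 * (h / (1 - x)) * gap x) by ring.
  by rewrite mulrBl mul1r; lra.
have upper : derive1 gap x <= k1 * gap x / (1 + x).
  apply: (derive1_le_left ex1 dgap') => h /andP[h0 h1].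
  have := @gap_dilation R wb m Rc n x (x - h) (-1) (1 - h / (1 + x)) cw m0 Rc0 wm wbL n0 x1.
  rewrite -/(gap x) -/(gap (x - h)) -/k1 opprB addrCA subrr addr0.
  have hx : 0 < h / (1 + x) < 1 by rewrite divr_gt0//= ltr_pdivrMr// mul1r.
  have e1 : x - h = -1 + (1 - h / (1 + x)) * (x - -1) by field; rewrite gt_eqF.
  have i1 : -1 <= (-1 : R) <= 1 by lra.
  have i2 : 0 < 1 - h / (1 + x) < 1 by lra.
  move=> /(_ i1 i2 e1).
  have -> : k1 * gap x / (1 + x) * h = k1 * (h / (1 + x)) * gap x by ring.
  by rewrite mulrBl mul1r; lra.
have gl : k1 * gap x <= k1 * lam by rewrite ler_pM2l.
have Cl : k1 * lam <= (8 * k1 + k2) * lam by rewrite ler_wpM2r//; lra.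
split.
  rewrite gapE; apply: le_trans lower; rewrite !mulNr lerN2 ler_pM2r ?invr_gt0//.
  exact: le_trans gl Cl.
have nn : 0 < n%:R ^+ 2 :> R by rewrite exprn_gt0// ltr0n.
(* In the first case n^2 is the minimum and [w x], being positive, is simply dropped; in the second,
   1/(8(1 + x)) is below n^2. *)
have [xn|xn] := leP (8 * n%:R ^+ 2 * (1 + x)) 1.
  have -> : Num.min (1 / (1 + x)) (n%:R ^+ 2) = n%:R ^+ 2.
    rewrite min_r// ler_pdivlMr//.
    have : 0 <= n%:R ^+ 2 * (1 + x) by rewrite mulr_ge0// ltW.
    by rewrite -mulrA in xn; lra.
  have := derive1_pi_endpoint cw m0 wmM n0 x1 xn dpi; rewrite -/k2 -/lam => h.
  have wx := wm x x2.
  apply: le_trans (_ : k2 * n%:R ^+ 2 * lam <= _); first lra.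
  rewrite mulrAC ler_pM2r// ler_wpM2r//; lra.
rewrite gapE; apply: le_trans upper _.
apply: le_trans (_ : (8 * k1) * lam * (1 / 8 * (1 / (1 + x))) <= _).
  have -> : 8 * k1 * lam * (1 / 8 * (1 / (1 + x))) = k1 * lam / (1 + x).
    by field; rewrite gt_eqF.
  by rewrite ler_pM2r ?invr_gt0.
apply: ler_pM.
- by rewrite mulr_ge0// mulr_ge0// ltW.
- by rewrite !mulr_ge0// ?invr_ge0 ltW.
- by rewrite ler_wpM2r//; lra.
- have ix : 0 < 1 / (1 + x) by rewrite divr_gt0.
  rewrite le_min; apply/andP; split; first lra.
  rewrite mulrA mulr1 ler_pdivrMr//; lra.
Qed.
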